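(* Let $C=C[F;H]$, with metric $g_C$, be the Lorentzian cylinder constructed out of a connected Riemannian manifold $(F,g_F)$ (admitting a non-vanishing parallel spinor and a Codazzi tensor with eigenvalues uniformly bounded from below) and a Codazzi tensor $H$ on the warped product $(M=\mathbb{R}\times F,\ g_{wp}=ds^2+e^{-4s}g_F)$ with positive eigenvalues uniformly bounded away from zero. Put $H_t=H-2t\,\mathrm{Id}$ and $M_t=\{t\}\times M$. The curvature of $C[F;H]$ satisfies: (i) $R^C(X,Y)\partial_t=R^C(X,\partial_t)Y=R^C(X,\partial_t)\partial_t=0$ for all vector fields $X,Y$ on $C$. (ii) If $X,Y,V\in TM_t$, then $$R^C(X,Y)V=(H_t^{-1}\circ R^{wp}(X,Y)\circ H_t)V-4g_{wp}(X,H_tV)H_t^{-1}Y+4g_{wp}(Y,H_tV)H_t^{-1}X.$$ (iii) If the vectors $X,Y,V\in TM_t$ are lifts of vectors in $TF$, then $$R^C(X,Y)H_t^{-1}V=H_t^{-1}R^F(X,Y)V.$$ (iv) If the vectors $X,Y\in TM_t$ are lifts of vectors in $TF$, then $$R^C(X,Y)H_t^{-1}(\partial_s)=R^C(\partial_s,Y)H_t^{-1}(\partial_s)=R^C(\partial_s,Y)H_t^{-1}(X)=0.$$ In particular, $C[F;H]$ is flat if and only if $(F,g_F)$ is flat.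
   Context: A Codazzi tensor on a Riemannian manifold $(N,h)$ is an $h$-symmetric endomorphism field $T$ of $TN$ with $(\nabla_XT)(Y)=(\nabla_YT)(X)$ for all vector fields $X,Y$. $B^*h(X,Y):=h(BX,BY)$. Curvature convention: $R(X,Y)Z=\nabla_X\nabla_YZ-\nabla_Y\nabla_XZ-\nabla_{[X,Y]}Z$; $R^C,R^{wp},R^F$ are the curvature tensors of $g_C,g_{wp},g_F$. The cylinder $C[F;H]$: let $(F,g_F)$ be a connected Riemannian manifold which admits a non-vanishing parallel spinor and a Codazzi tensor with eigenvalues uniformly bounded from below. Put $M:=\mathbb{R}\times F$ (with coordinate $s$ on $\mathbb{R}$), $g_{wp}:=ds^2+e^{-4s}g_F$, and let $H$ be a Codazzi tensor on $(M,g_{wp})$ with positive eigenvalues uniformly bounded away from zero ($\|H^{-1}\|\le c<\infty$ on $M$). Then $$C[F;H]:=(a,b)\times M,\qquad g_C:=-dt^2+H_t^*g_{wp},$$ where $a$ is half of the supremum of all negative eigenvalues of $H$, or $-\infty$ if all eigenvalues of $H$ are positive, and $b$ is half of the infimum of all positive eigenvalues of $H$, or $+\infty$ if all eigenvalues are negative. *)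

(* Defs.v *)
(* Conventions.
   - A manifold is given by an atlas; a field of tangent vectors (resp. of
     endomorphisms, of bilinear forms) is the family of its components in the
     charts of the atlas, related on overlaps by the Jacobians of the
     coordinate changes.
   - Tangent vectors are row vectors, so an endomorphism T acts by X *m T, a
     bilinear form h by X *m h *m Y^T, and T^*h has matrix T *m h *m T^T.
   - Fields are total functions, but only their values on the open set D under
     consideration matter.  "For all vector fields" is read as "for all smooth
     vector fields on open subsets". *)
From HB Require Import structures.
From mathcomp Require Import all_boot all_order all_algebra.
From mathcomp Require Import complex.
From mathcomp Require Import all_classical all_reals all_analysis.
Set Implicit Arguments.
Unset Strict Implicit.
Unset Printing Implicit Defensive.
Import Order.TTheory GRing.Theory Num.Theory numFieldNormedType.Exports.
Local Open Scope classical_set_scope.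
Local Open Scope ring_scope.

(* Meant for open V. *)
Fixpoint Ck (R : realType) (n k : nat) (V : set 'rV[R]_n) (f : 'rV[R]_n -> R)
    {struct k} : Prop :=
  (forall x, V x -> {for x, continuous f}) /\
  match k with
  | 0 => True
  | k'.+1 => forall j : 'I_n,
      (forall x, V x -> derivable f x (delta_mx 0 j)) /\
      Ck k' V (fun x => 'D_(delta_mx 0 j) f x)
  end.

Definition Cinfty (R : realType) (n : nat) (V : set 'rV[R]_n)
    (f : 'rV[R]_n -> R) : Prop :=
  forall k, Ck k V f.

(* The chart domains need not cover T: an atlas describes the open subset of T
   that they do cover.  [cinv i] is the inverse of [chart i] on its image. *)
Record atlas (R : realType) (n : nat) (T : Type) := Atlas {
  idx : Type;
  dom : idx -> set T;
  chart : idx -> T -> 'rV[R]_n;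
  cinv : idx -> 'rV[R]_n -> T }.
Arguments dom {R n T} _ _.
Arguments chart {R n T} _ _.
Arguments cinv {R n T} _ _.

Definition vfields R n T (A : atlas R n T) := idx A -> T -> 'rV[R]_n.
Definition efields R n T (A : atlas R n T) := idx A -> T -> 'M[R]_n.
Definition bfields R n T (A : atlas R n T) := idx A -> T -> 'M[R]_n.

Section Calculus.
Variables (R : realType) (n : nat) (T : topologicalType) (A : atlas R n T).

Definition smooth_on (D : set T) (f : T -> R) : Prop :=
  forall i, Cinfty (chart A i @` (D `&` dom A i)) (f \o cinv A i).

Record smooth_manifold : Prop := SmoothManifold {
  sm_hausdorff : hausdorff_space T;
  sm_countable : @second_countable T;
  sm_cover : forall p, exists i, dom A i p;
  sm_dom_open : forall i, open (dom A i);
  sm_img_open : forall i, open (chart A i @` dom A i);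
  sm_cinvK : forall i p, dom A i p -> cinv A i (chart A i p) = p;
  sm_chart_cont : forall i p, dom A i p -> {for p, continuous (chart A i)};
  sm_cinv_cont : forall i x,
    (chart A i @` dom A i) x -> {for x, continuous (cinv A i)};
  sm_transition : forall j k, smooth_on (dom A j) (fun p => chart A j p 0 k) }.

(* The k-th coordinate derivative of f at p in the chart i. *)
Definition pd (i : idx A) (k : 'I_n) (f : T -> R) (p : T) : R :=
  'D_(delta_mx 0 k) (f \o cinv A i) (chart A i p).

Definition jac (i j : idx A) (p : T) : 'M[R]_n :=
  \matrix_(a, b) pd i a (fun q => chart A j q 0 b) p.

Definition vector_field (D : set T) (X : vfields A) : Prop :=
  (forall i k, smooth_on (D `&` dom A i) (fun p => X i p 0 k)) /\
  (forall i j p, D p -> dom A i p -> dom A j p ->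
     X j p = X i p *m jac i j p).

Definition endo_field (E : efields A) : Prop :=
  (forall i k l, smooth_on (dom A i) (fun p => E i p k l)) /\
  (forall i j p, dom A i p -> dom A j p ->
     jac i j p *m E j p = E i p *m jac i j p).

Definition bilin_field (h : bfields A) : Prop :=
  (forall i k l, smooth_on (dom A i) (fun p => h i p k l)) /\
  (forall i j p, dom A i p -> dom A j p ->
     h i p = jac i j p *m h j p *m (jac i j p)^T).

Definition bval (h : 'M[R]_n) (u v : 'rV[R]_n) : R := (u *m h *m v^T) 0 0.

Definition riemannian (g : bfields A) : Prop :=
  bilin_field g /\
  forall i p, dom A i p ->
    (forall u v, bval (g i p) u v = bval (g i p) v u) /\
    (forall u, u != 0 -> 0 < bval (g i p) u u).

(* X(f), and the complex version. *)
Definition der (X : vfields A) (i : idx A) (f : T -> R) (p : T) : R :=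
  \sum_a X i p 0 a * pd i a f p.

Definition derC (X : vfields A) (i : idx A) (f : T -> R[i]) (p : T) : R[i] :=
  (der X i (fun q => complex.Re (f q)) p
   +i* der X i (fun q => complex.Im (f q)) p)%C.

Definition lie (X Y : vfields A) : vfields A := fun i p =>
  \row_k (der X i (fun q => Y i q 0 k) p - der Y i (fun q => X i q 0 k) p).

(* The Levi-Civita connection, through its Christoffel symbols; the formula
   makes sense in any signature. *)
Definition christoffel (g : bfields A) (i : idx A) (p : T) (k a b : 'I_n) : R :=
  2^-1 * \sum_l invmx (g i p) k l *
    (pd i a (fun q => g i q b l) p + pd i b (fun q => g i q a l) p
     - pd i l (fun q => g i q a b) p).

Definition nabla (g : bfields A) (X Y : vfields A) : vfields A := fun i p =>
  \row_k (der X i (fun q => Y i q 0 k) p +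
          \sum_a \sum_b christoffel g i p k a b * X i p 0 a * Y i p 0 b).

Definition curv (g : bfields A) (X Y Z : vfields A) : vfields A := fun i p =>
  nabla g X (nabla g Y Z) i p - nabla g Y (nabla g X Z) i p
  - nabla g (lie X Y) Z i p.

Definition flat (g : bfields A) : Prop :=
  forall (D : set T) (X Y Z : vfields A), open D ->
    vector_field D X -> vector_field D Y -> vector_field D Z ->
  forall i p, D p -> dom A i p -> curv g X Y Z i p = 0.

Definition eapp (E : efields A) (X : vfields A) : vfields A :=
  fun i p => X i p *m E i p.

(* (nabla_X E)(Y) *)
Definition nablaE (g : bfields A) (X : vfields A) (E : efields A)
    (Y : vfields A) : vfields A := fun i p =>
  nabla g X (eapp E Y) i p - eapp E (nabla g X Y) i p.

Definition codazzi (g : bfields A) (E : efields A) : Prop :=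
  [/\ endo_field E,
      forall i p, dom A i p -> forall u v,
        bval (g i p) (u *m E i p) v = bval (g i p) u (v *m E i p)
    & forall (D : set T) (X Y : vfields A), open D ->
        vector_field D X -> vector_field D Y ->
      forall i p, D p -> dom A i p -> nablaE g X E Y i p = nablaE g Y E X i p].

Definition eigenvals (E : efields A) : set R :=
  [set l | exists i p, dom A i p /\ eigenvalue (E i p) l].

End Calculus.

Section Spin.
Variables (R : realType) (n : nat).

(* 2^[n/2] is the dimension of the irreducible complex modules over the
   Clifford algebra of R^n with v.v = -|v|^2, so any matrices as below define
   the spinor module. *)
Definition spdim : nat := (2 ^ n./2)%N.

Definition clifford_rep (gam : 'I_n -> 'M[R[i]]_spdim) : Prop :=
  forall k l, gam k *m gam l + gam l *m gam k = ((- 2) *+ (k == l))%:M.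

Definition cliff (gam : 'I_n -> 'M[R[i]]_spdim) (v : 'rV[R]_n) : 'M[R[i]]_spdim :=
  \sum_k (v 0 k)%:C%C *: gam k.

(* Spin(n), as a group of matrices: the spinor representation is faithful. *)
Definition spin_group (gam : 'I_n -> 'M[R[i]]_spdim) : set 'M[R[i]]_spdim :=
  [set S | exists s : seq 'rV[R]_n,
     [/\ ~~ odd (size s), forall v, v \in s -> (v *m v^T) 0 0 = 1
       & S = \big[mulmx/1%:M]_(v <- s) cliff gam v]].

Variables (T : topologicalType) (A : atlas R n T) (g : bfields A).

Definition smoothC_on (D : set T) (f : T -> R[i]) : Prop :=
  smooth_on A D (fun p => complex.Re (f p)) /\
  smooth_on A D (fun p => complex.Im (f p)).

(* A spin structure, in local trivialisations: an open cover W with orthonormal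
   frames e on its members, and Spin(n)-valued cocycles S whose images under
   Spin(n) -> SO(n) are the transition functions of the frames. *)
Record spin_structure (gam : 'I_n -> 'M[R[i]]_spdim) (K : Type)
    (W : K -> set T) (e : K -> 'I_n -> vfields A)
    (S : K -> K -> T -> 'M[R[i]]_spdim) : Prop := SpinStructure {
  ss_open : forall k, open (W k);
  ss_cover : forall p, exists k, W k p;
  ss_frame : forall k a, vector_field (W k) (e k a);
  ss_orthonormal : forall k i p, W k p -> dom A i p ->
    forall a b, bval (g i p) (e k a i p) (e k b i p) = (a == b)%:R;
  ss_smooth : forall k l r c,
    smoothC_on (W k `&` W l) (fun p => S k l p r c);
  ss_spin : forall k l p, W k p -> W l p -> spin_group gam (S k l p);
  ss_lift : forall k l i p, W k p -> W l p -> dom A i p ->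
    forall a, S k l p *m gam a =
      cliff gam (\row_b bval (g i p) (e l a i p) (e k b i p)) *m S k l p;
  ss_cocycle : forall k l m p, W k p -> W l p -> W m p ->
    S k l p *m S l m p = S k m p }.

Definition spinor_field (K : Type) (W : K -> set T)
    (S : K -> K -> T -> 'M[R[i]]_spdim) (psi : K -> T -> 'cV[R[i]]_spdim) :
    Prop :=
  (forall k r, smoothC_on (W k) (fun p => psi k p r 0)) /\
  (forall k l p, W k p -> W l p -> psi k p = S k l p *m psi l p).

(* The spinor connection in the frame e:
   X(psi) + 1/2 sum_(a<b) g(nabla_X e_a, e_b) e_a.e_b.psi *)
Definition spin_nabla (gam : 'I_n -> 'M[R[i]]_spdim) (e : 'I_n -> vfields A)
    (X : vfields A) (psi : T -> 'cV[R[i]]_spdim) (i : idx A) (p : T) :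
    'cV[R[i]]_spdim :=
  \col_r derC X i (fun q => psi q r 0) p +
  2^-1 *: \sum_(a < n) \sum_(b < n | (a < b)%N)
    (bval (g i p) (nabla g X (e a) i p) (e b i p))%:C%C *:
      (gam a *m gam b *m psi p).

Definition admits_parallel_spinor : Prop :=
  exists (gam : 'I_n -> 'M[R[i]]_spdim) (K : Type) (W : K -> set T)
         (e : K -> 'I_n -> vfields A) (S : K -> K -> T -> 'M[R[i]]_spdim)
         (psi : K -> T -> 'cV[R[i]]_spdim),
    [/\ clifford_rep gam, spin_structure gam W e S, spinor_field W S psi,
        forall k p, W k p -> psi k p != 0
      & forall (D : set T) (X : vfields A), open D -> vector_field D X ->
        forall k i p, D p -> W k p -> dom A i p ->
          spin_nabla gam (e k) X (psi k) i p = 0].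

End Spin.

(* The product J x N of an open set J of reals with a manifold N, seen inside
   R x T. *)
Section Line.
Variables (R : realType) (n : nat) (T : topologicalType).

Definition line_atlas (J : set R) (A : atlas R n T) :
    atlas R (1 + n)%N (R * T)%type :=
  @Atlas R (1 + n)%N (R * T)%type (idx A)
    (fun i => [set q | J q.1 /\ dom A i q.2])
    (fun i q => row_mx (q.1)%:M (chart A i q.2))
    (fun i x => (lsubmx x 0 0, cinv A i (rsubmx x))).

Variables (J : set R) (A : atlas R n T).

Definition dline : vfields (line_atlas J A) := fun _ _ => row_mx 1%:M 0.

Definition lift_vf (X : vfields A) : vfields (line_atlas J A) :=
  fun i q => row_mx 0 (X i q.2).

Definition tangent_to_slices (D : set (R * T)) (X : vfields (line_atlas J A)) :=
  forall i q, D q -> dom (line_atlas J A) i q -> lsubmx (X i q) = 0.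

Definition slice (t : R) (X : vfields (line_atlas J A)) : vfields A :=
  fun i x => rsubmx (X i (t, x)).

End Line.
Arguments dline {R n T} J A _ _.
Arguments slice {R n T J A} t X _ _.
Arguments lift_vf {R n T} J {A} X _ _.

Section Cylinder.
Variables (R : realType) (n : nat) (F : topologicalType) (A : atlas R n F).

Definition wp_atlas : atlas R (1 + n)%N (R * F)%type := line_atlas setT A.

Definition wp_metric (gF : bfields A) : bfields wp_atlas :=
  fun i x => block_mx 1%:M 0 0 (expR (- 4 * x.1) *: gF i x.2).

Variable H : efields wp_atlas.

Definition Ht (t : R) : efields wp_atlas := fun i x => H i x - (2 * t)%:M.

Definition Htinv (t : R) : efields wp_atlas := fun i x => invmx (Ht t i x).

(* ereal_sup set0 = -oo and ereal_inf set0 = +oo *)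
Definition cyl_a : \bar R :=
  ereal_sup [set (l / 2)%:E | l in [set l | eigenvals H l /\ l < 0]].

Definition cyl_b : \bar R :=
  ereal_inf [set (l / 2)%:E | l in [set l | eigenvals H l /\ 0 < l]].

Definition cyl_interval : set R :=
  [set t | (cyl_a < t%:E)%E /\ (t%:E < cyl_b)%E].

Definition cyl_atlas : atlas R (1 + (1 + n))%N (R * (R * F))%type :=
  line_atlas cyl_interval wp_atlas.

Definition cyl_metric (gF : bfields A) : bfields cyl_atlas := fun i q =>
  block_mx (- 1)%:M 0 0
    (Ht q.1 i q.2 *m wp_metric gF i q.2 *m (Ht q.1 i q.2)^T).

Definition d_t : vfields cyl_atlas := dline cyl_interval wp_atlas.

Definition d_s : vfields wp_atlas := dline setT A.

(* The field on the cylinder that is X, tangent to M, on every slice. *)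
Definition to_cyl (X : vfields wp_atlas) : vfields cyl_atlas :=
  lift_vf cyl_interval X.

(* H_t^{-1} X, for X tangent to M, as a field on the cylinder. *)
Definition Htinv_cyl (X : vfields wp_atlas) : vfields cyl_atlas :=
  fun i q => row_mx 0 (eapp (Htinv q.1) X i q.2).

Definition fiber_lift (X : vfields A) : vfields wp_atlas := lift_vf setT X.

End Cylinder.
Arguments d_t {R n F A} H _ _.
Arguments d_s {R n F} A _ _.
Arguments wp_metric {R n F A} gF _ _.
Arguments cyl_metric {R n F A} H gF _ _.
Arguments Ht {R n F A} H t _ _.
Arguments Htinv {R n F A} H t _ _.
Arguments to_cyl {R n F A} H X _ _.
Arguments Htinv_cyl {R n F A} H X _ _.
Arguments fiber_lift {R n F A} X _ _.

(* Main.v *)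
(* In the frame formed by d_t and the H_t^-1 X, X tangent to M, the Levi-Civita
   connection of the cylinder does not depend on t and has no dt-component: the
   Codazzi equation makes H_t^-1 o nabla^wp o H_t torsion free, and d_t H_t = -2
   is exactly what makes nabla_t (H_t^-1 X) vanish.  The same computation, with
   the identity in place of H_t, describes the warped product ds^2+e^{-4s} gF.
   In such a frame the curvature of a line times N is that of N plus a term of
   constant curvature -4 for the warped product (a Riemannian line) and +4 for
   the cylinder (a Lorentzian line); the two cancel, so that only the curvature
   of F survives. *)
Require Import Defs.
From mathcomp Require Import all_boot all_order all_algebra.
From mathcomp Require Import complex.
From mathcomp Require Import all_classical all_reals all_analysis.
From mathcomp Require Import ring.
Import Order.TTheory GRing.Theory Num.Theory numFieldNormedType.Exports.
Set Implicit Arguments.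
Unset Strict Implicit.
Unset Printing Implicit Defensive.
Local Open Scope classical_set_scope.
Local Open Scope ring_scope.

(** * Calculus in several variables *)

(** The frame formed by d_t and the H_t^-1 X is not a coordinate frame, yet its brackets never have
    to be computed: only values are expressed in it, while derivatives stay along coordinate fields.
    Passing to the frame is then a gauge transformation P of the connection matrices, under which
    the curvature matrices K satisfy K P = P K'. Vectors being rows, products stand in the reverse
    of the usual order. The gauge law rests on the symmetry of second derivatives, hence the
    calculus below. The Christoffel symbols of the two metrics are not computed from their
    definition. A candidate connection is written down, checked to be torsion free and metric, and
    identified by uniqueness. The constants -4 and +4 come from the Gauss equation. With E the
    identity on the warped product and H_t on the cylinder, the unit field d along the line
    satisfies nabla_X d = -2 E^-1 X in both cases: half the logarithmic derivative of e^{-4s} is -2,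
    and so is the derivative of H_t in t. The slices therefore contribute curvature -eps (-2)^2,
    where eps = g(d,d) is 1 or -1. *)

Section OneVariable.
Variables (R : realType) (V : normedModType R).
Implicit Types (f : V -> R) (x v : V).

Lemma derive_line f x v (t : R) :
  (derivable f (x + t *: v) v = derivable (fun s : R => f (x + s *: v)) t 1) *
  ('D_v f (x + t *: v) = 'D_1 (fun s : R => f (x + s *: v)) t).
Proof.
rewrite /derivable /derive.
suff -> : (fun h : R => h^-1 *: ((f \o shift (x + t *: v)) (h *: v) - f (x + t *: v)))
  = (fun h : R => h^-1 *: (((fun s : R => f (x + s *: v)) \o shift t) (h *: (1 : R)) -
                           f (x + t *: v))) by [].
apply/funext => h /=.
by rewrite [h *: 1]mulr1 scalerDl addrCA.
Qed.

Lemma MVT_line f x v (h : R) :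
  (forall s, `|s| <= `|h| -> derivable f (x + s *: v) v) ->
  exists2 s, `|s| <= `|h| & f (x + h *: v) - f x = h * 'D_v f (x + s *: v).
Proof.
move=> df; pose phi s := f (x + s *: v).
have main a b : a <= b -> (forall s, a <= s <= b -> `|s| <= `|h|) ->
    exists2 s, `|s| <= `|h| & phi b - phi a = 'D_v f (x + s *: v) * (b - a).
  move=> ab abh.
  have dphi s : a <= s <= b -> is_derive s 1 phi ('D_v f (x + s *: v)).
    move=> /abh sh; apply: DeriveDef; last by rewrite derive_line.
    by rewrite -derive_line; exact: df.
  have [| |c] := @MVT_segment R phi (fun s => 'D_v f (x + s *: v)) a b ab.
  - by move=> s; rewrite in_itv/= => /andP[/ltW ? /ltW ?]; apply: dphi; apply/andP.
  - by apply: derivable_within_continuous => s; rewrite in_itv/= => /dphi[].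
  rewrite in_itv/= => cab e; exists c => //; exact: abh.
have [h0|/ltW h0] := leP 0 h.
  have [|s sh e] := main 0 h h0.
    by move=> s /andP[? ?]; rewrite !ger0_norm.
  by exists s => //; move: e; rewrite /phi scale0r addr0 subr0 mulrC.
have [|s sh e] := main h 0 h0.
  by move=> s /andP[? ?]; rewrite !ler0_norm ?lerN2.
exists s => //; rewrite -opprB -[f x]/(f (x)).
by move: e; rewrite /phi scale0r addr0 sub0r => ->; rewrite mulrN opprK mulrC.
Qed.

(** Only the behaviour of [L] on the line through [x] in direction [v] matters, since the two
    difference quotients agree term by term. It serves for coordinate functions, translations,
    scalings and inclusions of slices. *)
Lemma derive_linear_comp (W : normedModType R) (f : W -> R) (L : V -> W) x v w :
  (forall h : R, L (h *: v + x) = h *: w + L x) ->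
  (derivable (f \o L) x v = derivable f (L x) w) *
  ('D_v (f \o L) x = 'D_w f (L x)).
Proof.
move=> Lh; rewrite /derivable /derive.
suff -> : (fun h : R => h^-1 *: (((f \o L) \o shift x) (h *: v) - (f \o L) x))
  = (fun h : R => h^-1 *: ((f \o shift (L x)) (h *: w) - f (L x))) by [].
by apply/funext => h /=; rewrite Lh.
Qed.

End OneVariable.

(** * Chain rule and symmetry of second derivatives, from partial derivatives *)

Section Partials.
Variable R : realType.

Lemma near_rV (m : nat) (x : 'rV[R]_m) (P : set 'rV[R]_m) :
  (\forall y \near x, P y) <->
  exists2 e : R, 0 < e & forall y : 'rV[R]_m, (forall j, `|y 0 j - x 0 j| < e) -> P y.
Proof.
split=> [/nbhs_ballP[e e0 eP]|[e e0 eP]].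
  exists e => // y yx; apply: eP; split=> // i j.
  by rewrite ord1 /ball/= distrC.
apply/nbhs_ballP; exists e => // y [_ yx]; apply: eP => j.
by have := yx 0 j; rewrite /ball/= distrC.
Qed.

Lemma continuous_rV (T : topologicalType) (m : nat) (f : T -> 'rV[R]_m) (x : T) :
  (forall j, {for x, continuous (fun y => f y 0 j)}) -> {for x, continuous f}.
Proof.
move=> cf A /near_rV[e e0 eA]; rewrite /= nbhs_filterE.
have : \forall y \near x, forall j, `|f y 0 j - f x 0 j| < e.
  apply: filter_forall => j.
  have /cvgrPdist_lt/(_ e e0) := cf j.
  by apply: filterS => y; rewrite distrC.
by apply: filterS => y yx; apply: eA.
Qed.

(* Replacing the coordinates one at a time, with the mean value theorem at each
   step. *)
Lemma increment_partials (m : nat) (f : 'rV[R]_m -> R) (y z : 'rV[R]_m) (e : R) :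
  (forall j, `|z 0 j - y 0 j| < e) ->
  (forall u : 'rV[R]_m, (forall j, `|u 0 j - y 0 j| < e) ->
     forall a, derivable f u (delta_mx 0 a)) ->
  exists u : 'I_m -> 'rV[R]_m,
    (forall a j, `|u a 0 j - y 0 j| <= `|z 0 j - y 0 j|) /\
    f z - f y = \sum_a (z 0 a - y 0 a) * 'D_(delta_mx 0 a) f (u a).
Proof.
move=> zy df.
pose w k : 'rV[R]_m := \row_j (if (j < k)%N then z 0 j else y 0 j).
have wS (a : 'I_m) (s : R) j : (w a + s *: delta_mx 0 a) 0 j =
    if j == a then y 0 a + s else w a 0 j.
  rewrite !mxE eqxx/=; case: eqVneq => [->|]; last by rewrite mulr0 addr0.
  by rewrite ltnn mulr1.
have bnd (a : 'I_m) (s : R) j : `|s| <= `|z 0 a - y 0 a| ->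
    `|(w a + s *: delta_mx 0 a) 0 j - y 0 j| <= `|z 0 j - y 0 j|.
  rewrite wS; case: eqVneq => [-> |_ _]; first by rewrite addrAC subrr add0r.
  by rewrite mxE; case: ifP => // _; rewrite subrr normr0.
have key a : {s : R | `|s| <= `|z 0 a - y 0 a| /\
   f (w a.+1) - f (w a) = (z 0 a - y 0 a) * 'D_(delta_mx 0 a) f (w a + s *: delta_mx 0 a)}.
  apply: cid.
  have [|s sh E] := @MVT_line R _ f (w a) (delta_mx 0 a) (z 0 a - y 0 a).
    by move=> s sh; apply: df => j; exact: le_lt_trans (bnd a s j sh) (zy j).
  exists s; split=> //; rewrite -E; congr (f _ - _).
  apply/rowP => j; rewrite wS mxE ltnS leq_eqVlt.
  case: (eqVneq j a) => [->|ja]; first by rewrite eqxx/= addrCA subrr addr0.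
  by rewrite (inj_eq val_inj) (negPf ja)/= mxE.
exists (fun a : 'I_m => w a + sval (key a) *: delta_mx 0 a); split.
  by move=> a j; apply: bnd; case: (svalP (key a)).
transitivity (f (w m) - f (w 0%N)).
  by congr (f _ - f _); apply/rowP => j; rewrite mxE ?ltn_ord.
rewrite -(telescope_sumr (fun k => f (w k))) // big_mkord.
apply: eq_bigr => a _; by have [_] := svalP (key a).
Qed.

Lemma cvg_sumr (T I : Type) (r : seq I) (F : set_system T) (f : I -> T -> R)
    (l : I -> R) : Filter F -> (forall a, f a h @[h --> F] --> l a) ->
  (\sum_(a <- r) f a h) @[h --> F] --> \sum_(a <- r) l a.
Proof.
move=> FF fl; elim: r => [|a r IH].
  by rewrite big_nil; under eq_fun do rewrite big_nil; exact: cvg_cst.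
by rewrite big_cons; under eq_fun do rewrite big_cons; exact: cvgD.
Qed.

(** The hypotheses concern partial derivatives only, so the increment of [f] is split by
    [increment_partials]. The intermediate points tend to [phi x] because each of their coordinates
    is no farther from it than the corresponding coordinate of [phi (h *: v + x)]. *)
Lemma chain_rule (V : normedModType R) (m : nat) (f : 'rV[R]_m -> R)
    (phi : V -> 'rV[R]_m) (x v : V) :
  (\forall u \near phi x, forall a, derivable f u (delta_mx 0 a)) ->
  (forall a, {for phi x, continuous ('D_(delta_mx 0 a) f)}) ->
  (forall a, derivable (fun y => phi y 0 a) x v) ->
  is_derive x v (f \o phi)
    (\sum_a 'D_v (fun y => phi y 0 a) x * 'D_(delta_mx 0 a) f (phi x)).
Proof.
move=> /near_rV[e e0 df] cf dphi.
pose q a (h : R) := h^-1 * (phi (h *: v + x) 0 a - phi x 0 a).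
have cq a : q a h @[h --> 0^'] --> 'D_v (fun y => phi y 0 a) x by exact: dphi.
(* Derivability along [v] gives continuity along [v]: the increment is [h] times the difference
   quotient [q a h], which converges. *)
have cphi a : phi (h *: v + x) 0 a @[h --> 0^'] --> phi x 0 a.
  suff : (h * q a h + phi x 0 a) @[h --> 0^'] -->
     0 * ('D_v (fun y => phi y 0 a) x) + phi x 0 a.
    rewrite mul0r add0r => H; apply: cvg_trans H; apply: near_eq_cvg; near=> h.
    have h0 : h != 0 by near: h; exact: nbhs_dnbhs_neq.
    by rewrite /q mulVKf// subrK.
  apply: cvgD; last exact: cvg_cst.
  by apply: cvgM => //; exact: nbhs_dnbhs.
pose good (h : R) (u : 'I_m -> 'rV[R]_m) :=
  (forall a j, `|u a 0 j - phi x 0 j| <= `|phi (h *: v + x) 0 j - phi x 0 j|) /\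
  f (phi (h *: v + x)) - f (phi x) =
   \sum_a (phi (h *: v + x) 0 a - phi x 0 a) * 'D_(delta_mx 0 a) f (u a).
(* The intermediate points exist for each small [h] separately and must be chosen as a function of
   [h] to have a limit. The default [phi x] is taken only where no such points exist, which by [nU]
   does not happen near 0. *)
pose U h : 'I_m -> 'rV[R]_m := xget (fun=> phi x) (good h).
have nU : \forall h \near 0^', good h (U h).
  have : \forall h \near 0^', forall a, `|phi (h *: v + x) 0 a - phi x 0 a| < e.
    apply: filter_forall => a.
    have /cvgrPdist_lt/(_ e e0) := cphi a.
    by apply: filterS => h; rewrite distrC.
  apply: filterS => h hb; apply: xgetPex.
  exact: (increment_partials hb).
have cU a : U h a @[h --> 0^'] --> phi x.
  move=> P /near_rV[d d0 dP].
  have : \forall h \near 0^', forall j, `|phi (h *: v + x) 0 j - phi x 0 j| < d.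
    apply: filter_forall => j.
    have /cvgrPdist_lt/(_ d d0) := cphi j.
    by apply: filterS => h; rewrite distrC.
  move=> H; rewrite /= nbhs_filterE; apply: filterS2 H nU => h hd [gh _].
  by apply: dP => j; exact: le_lt_trans (gh a j) (hd j).
have lim : (fun h => h^-1 *: (((f \o phi) \o shift x) (h *: v) - (f \o phi) x)) @ 0^'
   --> \sum_a 'D_v (fun y => phi y 0 a) x * 'D_(delta_mx 0 a) f (phi x).
  have H : (\sum_a q a h * 'D_(delta_mx 0 a) f (U h a)) @[h --> 0^'] -->
     \sum_a 'D_v (fun y => phi y 0 a) x * 'D_(delta_mx 0 a) f (phi x).
    apply: cvg_sumr => a; apply: cvgM => //.
    exact: (cvg_comp _ _ (cU a) (cf a)).
  apply: cvg_trans H; apply: near_eq_cvg.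
  apply: filterS nU => h [_ gh] /=.
  rewrite gh [RHS]mulr_sumr; apply: eq_bigr => a _.
  by rewrite /q mulrA.
apply: DeriveDef; last exact: (cvg_lim _ lim).
by apply/cvg_ex; eexists; exact: lim.
Unshelve. all: by end_near. Qed.


(** Two applications of the mean value theorem: along [a] to the difference [psi] of [f] and its
    translate by [h] in direction [b], then along [b] to the [a]-derivative of [f]. *)
Lemma second_difference (m : nat) (f : 'rV[R]_m -> R) (x : 'rV[R]_m)
    (a b : 'I_m) (e h : R) :
  (forall y : 'rV[R]_m, (forall j, `|y 0 j - x 0 j| < e) ->
    derivable f y (delta_mx 0 a) /\
    derivable ('D_(delta_mx 0 a) f) y (delta_mx 0 b)) ->
  a != b -> `|h| < e ->
  exists2 y : 'rV[R]_m, (forall j, `|y 0 j - x 0 j| <= `|h|) &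
    f (x + h *: delta_mx 0 a + h *: delta_mx 0 b) - f (x + h *: delta_mx 0 a)
    - f (x + h *: delta_mx 0 b) + f x =
    h ^+ 2 * 'D_(delta_mx 0 b) ('D_(delta_mx 0 a) f) y.
Proof.
move=> df ab he.
have bnd (s t : R) j : `|s| <= `|h| -> `|t| <= `|h| ->
    `|(x + s *: delta_mx 0 a + t *: delta_mx 0 b) 0 j - x 0 j| <= `|h|.
  move=> sh th; rewrite !mxE eqxx/=.
  have [->|ja] := eqVneq j a.
    by rewrite (negPf ab) mulr0 addr0 mulr1 addrAC subrr add0r.
  have [_|jb] := eqVneq j b.
    by rewrite mulr0 addr0 mulr1 addrAC subrr add0r.
  by rewrite !mulr0 !addr0 subrr normr0.
pose psi (y : 'rV[R]_m) := f (y + h *: delta_mx 0 b) - f y.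
have dpsi (s : R) : `|s| <= `|h| ->
    is_derive (x + s *: delta_mx 0 a) (delta_mx 0 a) psi
      ('D_(delta_mx 0 a) f (x + s *: delta_mx 0 a + h *: delta_mx 0 b) -
       'D_(delta_mx 0 a) f (x + s *: delta_mx 0 a)).
  move=> sh; apply: is_deriveB.
    have := derive_linear_comp f (L := fun y => y + h *: delta_mx 0 b)
      (x := x + s *: delta_mx 0 a) (v := delta_mx 0 a) (w := delta_mx 0 a).
    case=> [k|E1 E2]; first by rewrite !addrA.
    apply: DeriveDef; last exact: E2.
    rewrite E1; apply: (df _ _).1 => j.
    exact: le_lt_trans (bnd s h j sh (lexx _)) he.
  apply: derivableP; apply: (df _ _).1 => j.
  have := bnd s 0 j sh; rewrite scale0r addr0 normr0 normr_ge0 => /(_ isT) H.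
  exact: le_lt_trans H he.
have dpsi' (s : R) : `|s| <= `|h| -> derivable psi (x + s *: delta_mx 0 a) (delta_mx 0 a).
  by case/dpsi.
have [s sh /= E1] := MVT_line dpsi'.
have [t th E2] := @MVT_line R _ ('D_(delta_mx 0 a) f) (x + s *: delta_mx 0 a)
    (delta_mx 0 b) h (fun t th => (df _ (fun j => le_lt_trans (bnd s t j sh th) he)).2).
exists (x + s *: delta_mx 0 a + t *: delta_mx 0 b); first by move=> j; exact: bnd.
have := dpsi s sh => /@derive_val E3.
move: E1; rewrite /psi E3 E2 mulrA -expr2 => <-.
by rewrite opprD opprK addrA.
Qed.

(** The second difference is symmetric in [a] and [b], so the two mixed derivatives agree at two
    points [y] and [z] close to [x]; continuity at [x] does the rest. *)
Lemma schwarz (m : nat) (f : 'rV[R]_m -> R) (x : 'rV[R]_m) (a b : 'I_m) :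
  (\forall y \near x, forall c, derivable f y (delta_mx 0 c) /\
     forall d, derivable ('D_(delta_mx 0 c) f) y (delta_mx 0 d)) ->
  (forall c d, {for x, continuous ('D_(delta_mx 0 d) ('D_(delta_mx 0 c) f))}) ->
  'D_(delta_mx 0 a) ('D_(delta_mx 0 b) f) x =
  'D_(delta_mx 0 b) ('D_(delta_mx 0 a) f) x.
Proof.
have [-> //|ab] := eqVneq a b; move=> /near_rV[e e0 df] cf.
apply/eqP; rewrite -subr_eq0 -normr_le0; apply/ler_addgt0Pr => d d0; rewrite add0r.
have d20 : 0 < d / 2 by rewrite divr_gt0.
have /cvgrPdist_lt/(_ _ d20)/near_rV[e1 e10 c1] := cf b a.
have /cvgrPdist_lt/(_ _ d20)/near_rV[e2 e20 c2] := cf a b.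
(* Half of the minimum: small enough for the second difference to be defined by [df], and for [y]
   and [z] to lie in both neighbourhoods where the mixed derivatives vary by less than [d / 2]. *)
pose h := Num.min e (Num.min e1 e2) / 2.
have h0 : 0 < h by rewrite divr_gt0 // !lt_min e0 e10.
have hlt : h < Num.min e (Num.min e1 e2).
  by rewrite ltr_pdivrMr// ltr_pMr ?ltr1n// !lt_min e0 e10.
move: (hlt); rewrite !lt_min => /and3P[he he1 he2].
have nh : `|h| = h by rewrite gtr0_norm.
have [|//||y yh Ey] := @second_difference m f x a b e h; rewrite ?nh//.
  by move=> y /df H; split; [exact: (H a).1|exact: (H a).2].
have [|||z zh Ez] := @second_difference m f x b a e h; rewrite ?nh// 1?eq_sym//.
  by move=> z /df H; split; [exact: (H b).1|exact: (H b).2].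
have : 'D_(delta_mx 0 b) ('D_(delta_mx 0 a) f) y =
       'D_(delta_mx 0 a) ('D_(delta_mx 0 b) f) z.
  apply: (@mulfI _ (h ^+ 2)); first by rewrite expf_neq0 ?gt_eqF.
  apply: (etrans (esym Ey)); apply: etrans _ Ez.
  by rewrite -!addrA [h *: delta_mx 0 b + h *: _]addrC; congr (_ + _); rewrite addrCA.
rewrite nh in yh zh.
have := c2 y (fun j => le_lt_trans (yh j) he2).
have := c1 z (fun j => le_lt_trans (zh j) he1).
move=> Cz Cy E; rewrite E in Cy.
rewrite [leRHS]splitr.
apply: le_trans (ler_distD ('D_(delta_mx 0 a) ('D_(delta_mx 0 b) f) z) _ _) _.
by apply: lerD; [exact: ltW Cz|rewrite distrC; exact: ltW Cy].
Qed.

End Partials.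

(** The direction is arbitrary because composing with a multiple c of a coordinate, as in e^{-4s},
    turns a unit direction into the direction c. *)
Lemma is_derive_expR_dir (R : realType) (x v : R) : is_derive x v expR (v * expR x).
Proof.
have dexp : differentiable (expR : R -> R) x.
  by apply/derivable1_diffP; exact: derivable_expR.
apply: DeriveDef; first exact: diff_derivable.
rewrite deriveE// deriv1E; last exact: derivable_expR.
by rewrite derive1E (@derive_val _ _ _ _ _ expR).
Qed.

(** * Stability of C^k functions under algebraic operations and composition *)

Section Smoothness.
Variables (R : realType) (n : nat).
Implicit Types (f g : 'rV[R]_n -> R) (V : set 'rV[R]_n).

Lemma Ck_continuous k V f x : Ck k V f -> V x -> {for x, continuous f}.
Proof. by case: k => [|k] [cf _]; exact: cf. Qed.

Lemma Ck_subset k V V' f : V' `<=` V -> Ck k V f -> Ck k V' f.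
Proof.
move=> VV'; elim: k f => [|k IH] f [cf df]; split=> //.
- by move=> x /VV'; exact: cf.
- by move=> x /VV'; exact: cf.
- by move=> j; have [dj cj] := df j; split; [move=> x /VV'; exact: dj|exact: IH].
Qed.

Lemma CkW k V f : Ck k.+1 V f -> Ck k V f.
Proof.
elim: k f => [|k IH] f [cf df]; split=> // j.
by have [dj cj] := df j; split=> //; exact: IH.
Qed.

(** Openness turns equality on [V] into equality near each point of [V], and this is what
    derivatives depend on. *)
Lemma Ck_eq k V f g : open V -> {in V, f =1 g} -> Ck k V f -> Ck k V g.
Proof.
move=> oV.
have near_fg f' g' x : {in V, f' =1 g'} -> V x -> \forall y \near x, f' y = g' y.
  move=> fg Vx; apply: filterS (open_nbhs_nbhs (conj oV Vx)) => y Vy.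
  by apply: fg; rewrite inE.
have cont f' g' x : {in V, f' =1 g'} -> {for x, continuous f'} -> V x ->
    {for x, continuous g'}.
  move=> fg cf Vx.
  have H : f' y @[y --> x] --> g' x by rewrite -fg ?inE.
  have N : \forall y \near nbhs x, f' y = g' y by exact: near_fg.
  have N' := near_eq_cvg N; apply: (cvg_trans _ H); exact: N'.
elim: k f g => [|k IH] f g fg [cf df].
  by split=> // x Vx; apply: cont fg (cf x Vx) Vx.
split=> [x Vx|j]; first by apply: cont fg (cf x Vx) Vx.
have [dj cj] := df j; split.
  by move=> x Vx; exact: near_eq_derivable (near_fg _ _ x fg Vx) (dj x Vx).
by apply: IH cj => x; rewrite inE => Vx; exact: near_eq_derive (near_fg _ _ x fg Vx).
Qed.

(** Introduction rule with a named candidate [df] for the partial derivatives. The candidate agrees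
    with them on [V] only, which [Ck_eq] makes sufficient. *)
Lemma CkS k V f (df : 'I_n -> 'rV[R]_n -> R) : open V ->
  (forall x, V x -> {for x, continuous f}) ->
  (forall j x, V x -> is_derive x (delta_mx 0 j) f (df j x)) ->
  (forall j, Ck k V (df j)) -> Ck k.+1 V f.
Proof.
move=> oV cf dfE cdf; split=> // j; split=> [x Vx|]; first by case: (dfE j x Vx).
by apply: Ck_eq (cdf j) => // x; rewrite inE => Vx; case: (dfE j x Vx).
Qed.

Lemma Ck_derive k V f j x : Ck k.+1 V f -> V x ->
  is_derive x (delta_mx 0 j) f ('D_(delta_mx 0 j) f x).
Proof. by move=> [_ df] Vx; apply: derivableP; case: (df j) => + _; exact. Qed.

Lemma Ck_partial k V f j : Ck k.+1 V f -> Ck k V ('D_(delta_mx 0 j) f).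
Proof. by move=> [_ /(_ j)[]]. Qed.

Lemma Cinfty_subset V V' f : V' `<=` V -> Cinfty V f -> Cinfty V' f.
Proof. by move=> VV' cf k; exact: Ck_subset VV' (cf k). Qed.

Lemma Cinfty_eq V f g : open V -> {in V, f =1 g} -> Cinfty V f -> Cinfty V g.
Proof. by move=> oV fg cf k; exact: Ck_eq fg (cf k). Qed.

Lemma Cinfty_partial V f j : Cinfty V f -> Cinfty V ('D_(delta_mx 0 j) f).
Proof. by move=> cf k; exact: Ck_partial. Qed.

Lemma Cinfty_derive V f j x : Cinfty V f -> V x ->
  is_derive x (delta_mx 0 j) f ('D_(delta_mx 0 j) f x).
Proof. by move=> /(_ 1%N); exact: Ck_derive. Qed.

Lemma Cinfty_schwarz V f a b x : open V -> Cinfty V f -> V x ->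
  'D_(delta_mx 0 a) ('D_(delta_mx 0 b) f) x =
  'D_(delta_mx 0 b) ('D_(delta_mx 0 a) f) x.
Proof.
move=> oV cf Vx; apply: schwarz => [|c d]; last first.
  by apply: (@Ck_continuous 0 V) => //; do 2!apply: Ck_partial; exact: cf.
apply: filterS (open_nbhs_nbhs (conj oV Vx)) => y Vy c.
split=> [|d]; first by case: (Cinfty_derive c cf Vy).
by case: (Cinfty_derive d (Cinfty_partial c cf) Vy).
Qed.

Lemma Ck_cst k V (c : R) : open V -> Ck k V (fun=> c).
Proof.
move=> oV; elim: k c => [|k IH] c; first by split=> // x _; exact: cst_continuous.
apply: (@CkS _ _ _ (fun _ _ => 0)) => //.
by move=> x _; exact: cst_continuous.
Qed.

Lemma Ck_add k V f g : open V -> Ck k V f -> Ck k V g ->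
  Ck k V (fun x => f x + g x).
Proof.
move=> oV; elim: k f g => [|k IH] f g cf cg.
  by split=> // x Vx; exact: continuousD (Ck_continuous cf Vx) (Ck_continuous cg Vx).
apply: (@CkS _ _ _ (fun j x => 'D_(delta_mx 0 j) f x + 'D_(delta_mx 0 j) g x)) => //.
- by move=> x Vx; exact: continuousD (Ck_continuous cf Vx) (Ck_continuous cg Vx).
- by move=> j x Vx; apply: is_deriveD; [exact: Ck_derive cf Vx|exact: Ck_derive cg Vx].
- by move=> j; apply: IH; exact: Ck_partial.
Qed.

Lemma Ck_mul k V f g : open V -> Ck k V f -> Ck k V g ->
  Ck k V (fun x => f x * g x).
Proof.
move=> oV; elim: k f g => [|k IH] f g cf cg.
  by split=> // x Vx; exact: continuousM (Ck_continuous cf Vx) (Ck_continuous cg Vx).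
apply: (@CkS _ _ _ (fun j x =>
   f x * 'D_(delta_mx 0 j) g x + g x * 'D_(delta_mx 0 j) f x)) => //.
- by move=> x Vx; exact: continuousM (Ck_continuous cf Vx) (Ck_continuous cg Vx).
- by move=> j x Vx; apply: is_deriveM; [exact: Ck_derive cf Vx|exact: Ck_derive cg Vx].
- by move=> j; apply: Ck_add => //; apply: IH; try exact: Ck_partial; exact: CkW.
Qed.

Lemma Ck_inv k V f : open V -> (forall x, V x -> f x != 0) -> Ck k V f ->
  Ck k V (fun x => (f x)^-1).
Proof.
move=> oV f0; elim: k => [|k IH] cf.
  by split=> // x Vx; exact: continuousV (f0 x Vx) (Ck_continuous cf Vx).
apply: (@CkS _ _ _ (fun j x =>
   - 1 * ((f x)^-1 * (f x)^-1) * 'D_(delta_mx 0 j) f x)) => //.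
- by move=> x Vx; exact: continuousV (f0 x Vx) (Ck_continuous cf Vx).
- move=> j x Vx; have [dfx _] := Ck_derive j cf Vx.
  apply: DeriveDef; first by apply: derivableV => //; exact: f0.
  rewrite deriveV//; last exact: f0.
  by rewrite mulN1r -invfM -expr2.
- move=> j; have IHf := IH (CkW cf).
  apply: Ck_mul => //; last exact: Ck_partial.
  by apply: Ck_mul => //; [exact: Ck_cst|exact: Ck_mul].
Qed.

Lemma Ck_coord k V j : open V -> Ck k V (fun x : 'rV[R]_n => x 0 j).
Proof.
move=> oV; case: k => [|k]; first by split=> // x _; exact: coord_continuous.
apply: (@CkS _ _ _ (fun a _ => (delta_mx 0 a : 'rV[R]_n) 0 j)) => //.
- by move=> x _; exact: coord_continuous.
- move=> a x _.
  have [h|E1 E2] := derive_linear_comp id (L := fun y : 'rV[R]_n => y 0 j)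
    (x := x) (v := delta_mx 0 a) (w := (delta_mx 0 a : 'rV[R]_n) 0 j).
    by rewrite !mxE.
  apply: DeriveDef; first by rewrite E1; exact: derivable_id.
  by rewrite E2 derive_id.
- by move=> a; exact: Ck_cst.
Qed.

Lemma Ck_expR k V (c : R) j : open V ->
  Ck k V (fun x : 'rV[R]_n => expR (c * x 0 j)).
Proof.
move=> oV.
have cont x : {for x, continuous (fun x : 'rV[R]_n => expR (c * x 0 j))}.
  apply: (@continuous_comp _ _ _ (fun x : 'rV[R]_n => c * x 0 j) expR).
    by apply: continuousM; [exact: cst_continuous|exact: coord_continuous].
  exact: continuous_expR.
elim: k => [|k IH]; first by split.
apply: (@CkS _ _ _ (fun a x => (c * (delta_mx 0 a : 'rV[R]_n) 0 j) * expR (c * x 0 j))) => //.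
- move=> a x _; set w := c * _.
  have [h|E1 E2] := derive_linear_comp expR (L := fun y : 'rV[R]_n => c * y 0 j)
    (x := x) (v := delta_mx 0 a) (w := w).
    by rewrite !mxE mulrDr /w mulrCA mxE.
  by apply: DeriveDef; rewrite ?E1 ?E2; case: (is_derive_expR_dir (c * x 0 j) w).
- by move=> a; apply: Ck_mul => //; exact: Ck_cst.
Qed.

Lemma Ck_sum (I : Type) (r : seq I) k V (F : I -> 'rV[R]_n -> R) : open V ->
  (forall a, Ck k V (F a)) -> Ck k V (fun x => \sum_(a <- r) F a x).
Proof.
move=> oV cF; elim: r => [|a r IH].
  by under eq_fun do rewrite big_nil; exact: Ck_cst.
by under eq_fun do rewrite big_cons; exact: Ck_add.
Qed.

Lemma Ck_prod (I : Type) (r : seq I) k V (F : I -> 'rV[R]_n -> R) : open V ->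
  (forall a, Ck k V (F a)) -> Ck k V (fun x => \prod_(a <- r) F a x).
Proof.
move=> oV cF; elim: r => [|a r IH].
  by under eq_fun do rewrite big_nil; exact: Ck_cst.
by under eq_fun do rewrite big_cons; exact: Ck_mul.
Qed.

End Smoothness.

(** Induction on [k] for all [f] at once: the chain rule expresses the derivatives through those of
    [phi] and through compositions of [phi] with the partial derivatives of [f], which are one order
    less regular. *)
Lemma Ck_comp (R : realType) (n m : nat) k (V : set 'rV[R]_n) (W : set 'rV[R]_m)
    (phi : 'rV[R]_n -> 'rV[R]_m) (f : 'rV[R]_m -> R) : open V -> open W ->
  (forall x, V x -> W (phi x)) -> (forall a, Ck k V (fun x => phi x 0 a)) ->
  Ck k W f -> Ck k V (f \o phi).
Proof.
move=> oV oW VW; elim: k f => [|k IH] f cphi cf.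
all: have cont x : V x -> {for x, continuous (f \o phi)} by
  (move=> Vx; apply: continuous_comp; last exact: Ck_continuous cf (VW x Vx);
   apply: continuous_rV => a; exact: Ck_continuous (cphi a) Vx).
  by split.
apply: (@CkS _ _ _ _ _ (fun j x => \sum_a 'D_(delta_mx 0 j) (fun y => phi y 0 a) x *
    'D_(delta_mx 0 a) f (phi x))) => //.
- move=> j x Vx; apply: chain_rule.
  + apply: filterS (open_nbhs_nbhs (conj oW (VW x Vx))) => y Wy a.
    by case: (Ck_derive a cf Wy).
  + by move=> a; exact: Ck_continuous (Ck_partial a cf) (VW x Vx).
  + by move=> a; case: (Ck_derive j (cphi a) Vx).
- move=> j; apply: Ck_sum => // a; apply: Ck_mul => //.
    exact: Ck_partial (cphi a).
  by apply: (IH ('D_(delta_mx 0 a) f)); [move=> b; exact: CkW|exact: Ck_partial].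
Qed.

(** * Calculus in the charts of an atlas *)

(** The local part of [smooth_manifold]. It passes to the product with an interval J, whose charts
    cover J x T but in general not all of R x T. *)
Record charted (R : realType) (n : nat) (T : topologicalType)
    (A : atlas R n T) : Prop := Charted {
  ch_dom_open : forall i, open (dom A i);
  ch_img_open : forall i, open (chart A i @` dom A i);
  ch_cinvK : forall i p, dom A i p -> cinv A i (chart A i p) = p;
  ch_cinv_cont : forall i x,
    (chart A i @` dom A i) x -> {for x, continuous (cinv A i)};
  ch_transition : forall j k, smooth_on A (dom A j) (fun p => chart A j p 0 k) }.

Lemma smooth_manifold_charted (R : realType) (n : nat) (T : topologicalType)
  (A : atlas R n T) : smooth_manifold A -> charted A.
Proof. by case=> *; split. Qed.

(** Smoothness read in the single chart [i] whose components are being computed with, whereas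
    [smooth_on] ranges over all charts. *)
Definition smooth_in (R : realType) (n : nat) (T : topologicalType)
    (A : atlas R n T) (i : idx A) (D : set T) (f : T -> R) : Prop :=
  Cinfty (chart A i @` (D `&` dom A i)) (f \o cinv A i).

Definition mx_smooth (R : realType) (n : nat) (T : topologicalType)
    (A : atlas R n T) (i : idx A) (D : set T) (r s : nat) (M : T -> 'M[R]_(r, s)) :=
  forall k l, smooth_in i D (fun q => M q k l).

Definition mpd (R : realType) (n : nat) (T : topologicalType)
    (A : atlas R n T) (i : idx A) (a : 'I_n) (r s : nat) (M : T -> 'M[R]_(r, s))
    (p : T) : 'M[R]_(r, s) :=
  \matrix_(k, l) pd i a (fun q => M q k l) p.

Section Charts.
Variables (R : realType) (n : nat) (T : topologicalType) (A : atlas R n T).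
Hypothesis cA : charted A.
Variables (i : idx A) (D : set T).
Hypothesis oD : open D.
Implicit Types (f g : T -> R) (p : T).

Let U := chart A i @` (D `&` dom A i).

(** [U] is the part of the open image of [dom A i] that [cinv A i] sends into [D], so openness
    follows from continuity of [cinv A i]. *)
Lemma open_chart_image : open U.
Proof.
have -> : U = (chart A i @` dom A i) `&` (cinv A i @^-1` D).
  apply/seteqP; split=> [x [p [Dp dp] <-]|x [[p dp <-] /=]].
    by split; [exists p|rewrite /= ch_cinvK].
  by rewrite ch_cinvK// => Dp; exists p.
rewrite openE => x [ix Dx].
have N1 : nbhs x (chart A i @` dom A i).
  by apply: open_nbhs_nbhs; split=> //; exact: ch_img_open.
have N2 : nbhs x (cinv A i @^-1` D).
  by apply: (ch_cinv_cont cA ix); apply: open_nbhs_nbhs; split.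
exact: filterI.
Qed.

Let oU := open_chart_image.

Lemma smooth_in_eq f g : (forall q, D q -> dom A i q -> f q = g q) ->
  smooth_in i D f -> smooth_in i D g.
Proof.
move=> fg; apply: Cinfty_eq => // x; rewrite inE => -[q [Dq dq] <-] /=.
by rewrite ch_cinvK//; exact: fg.
Qed.

Lemma smooth_in_cst (c : R) : smooth_in i D (fun=> c).
Proof. by move=> k; exact: Ck_cst. Qed.

Lemma smooth_in_add f g : smooth_in i D f -> smooth_in i D g ->
  smooth_in i D (fun q => f q + g q).
Proof. by move=> sf sg k; exact: Ck_add (sf k) (sg k). Qed.

Lemma smooth_in_mul f g : smooth_in i D f -> smooth_in i D g ->
  smooth_in i D (fun q => f q * g q).
Proof. by move=> sf sg k; exact: Ck_mul (sf k) (sg k). Qed.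

Lemma smooth_in_inv f : (forall q, D q -> dom A i q -> f q != 0) ->
  smooth_in i D f -> smooth_in i D (fun q => (f q)^-1).
Proof.
move=> f0 sf k; apply: Ck_inv (sf k) => // x [q [Dq dq] <-] /=.
by rewrite ch_cinvK//; exact: f0.
Qed.

Lemma smooth_in_sum (I : Type) (r : seq I) (F : I -> T -> R) :
  (forall a, smooth_in i D (F a)) -> smooth_in i D (fun q => \sum_(a <- r) F a q).
Proof.
by move=> sF k; apply: (@Ck_sum _ _ _ r k U (fun a => F a \o cinv A i)) => // a; exact: sF.
Qed.

Lemma smooth_in_prod (I : Type) (r : seq I) (F : I -> T -> R) :
  (forall a, smooth_in i D (F a)) -> smooth_in i D (fun q => \prod_(a <- r) F a q).
Proof.
by move=> sF k; apply: (@Ck_prod _ _ _ r k U (fun a => F a \o cinv A i)) => // a; exact: sF.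
Qed.

Lemma smooth_in_pd a f : smooth_in i D f -> smooth_in i D (pd i a f).
Proof.
move=> sf; apply: Cinfty_eq (Cinfty_partial a sf) => // x.
by rewrite inE => -[q [Dq dq] <-] /=; rewrite /pd ch_cinvK.
Qed.

Lemma pd_cst a (c : R) p : pd i a (fun=> c) p = 0.
Proof. exact: derive_cst. Qed.

Variable p : T.
Hypotheses (Dp : D p) (dp : dom A i p).

Let Up : U (chart A i p).
Proof. by exists p. Qed.

Lemma pd_eq a f g : (forall q, D q -> dom A i q -> f q = g q) ->
  pd i a f p = pd i a g p.
Proof.
move=> fg; apply: near_eq_derive.
apply: filterS (open_nbhs_nbhs (conj oU Up)) => x [q [Dq dq] <-] /=.
by rewrite ch_cinvK//; exact: fg.
Qed.

Lemma pdD a f g : smooth_in i D f -> smooth_in i D g ->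
  pd i a (fun q => f q + g q) p = pd i a f p + pd i a g p.
Proof.
move=> /(Cinfty_derive a)/(_ Up)[df _] /(Cinfty_derive a)/(_ Up)[dg _].
exact: deriveD.
Qed.

Lemma pdM a f g : smooth_in i D f -> smooth_in i D g ->
  pd i a (fun q => f q * g q) p = pd i a f p * g p + f p * pd i a g p.
Proof.
move=> /(Cinfty_derive a)/(_ Up)[df _] /(Cinfty_derive a)/(_ Up)[dg _].
rewrite /pd [LHS](deriveM df dg) /= ch_cinvK// addrC mulrC.
by congr (_ + _); rewrite mulrC.
Qed.

Lemma pd_sum a (I : Type) (r : seq I) (F : I -> T -> R) :
  (forall b, smooth_in i D (F b)) ->
  pd i a (fun q => \sum_(b <- r) F b q) p = \sum_(b <- r) pd i a (F b) p.
Proof.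
move=> sF; elim: r => [|b r IH].
  by under eq_fun do rewrite big_nil; rewrite big_nil pd_cst.
under eq_fun do rewrite big_cons.
by rewrite big_cons pdD ?IH//; exact: smooth_in_sum.
Qed.

Lemma pd_comm a b f : smooth_in i D f ->
  pd i a (pd i b f) p = pd i b (pd i a f) p.
Proof.
have E c d : pd i c (pd i d f) p =
    'D_(delta_mx 0 c) ('D_(delta_mx 0 d) (f \o cinv A i)) (chart A i p).
  apply: near_eq_derive.
  apply: filterS (open_nbhs_nbhs (conj oU Up)) => x [q [Dq dq] <-] /=.
  by rewrite /pd ch_cinvK.
by move=> sf; rewrite !E; exact: Cinfty_schwarz sf Up.
Qed.

End Charts.

(** * Entrywise calculus of matrix-valued functions *)

Section MatrixCalculus.
Variables (R : realType) (n : nat) (T : topologicalType) (A : atlas R n T).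
Hypothesis cA : charted A.
Variables (i : idx A) (D : set T).
Hypothesis oD : open D.

Section Closure.
Variables (r s t : nat).
Implicit Types (M N : T -> 'M[R]_(r, s)) (f : T -> R).

Lemma mx_smooth_eq M N : (forall q, D q -> dom A i q -> M q = N q) ->
  mx_smooth i D M -> mx_smooth i D N.
Proof.
by move=> MN sM k l; apply: smooth_in_eq (sM k l) => // q Dq dq; rewrite MN.
Qed.

Lemma mx_smooth_cst (c : 'M[R]_(r, s)) : mx_smooth i D (fun=> c).
Proof. by move=> k l; exact: smooth_in_cst. Qed.

Lemma mx_smoothD M N : mx_smooth i D M -> mx_smooth i D N ->
  mx_smooth i D (fun q => M q + N q).
Proof.
move=> sM sN k l; under eq_fun do rewrite mxE.
exact: smooth_in_add.
Qed.

Lemma mx_smoothZ f M : smooth_in i D f -> mx_smooth i D M ->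
  mx_smooth i D (fun q => f q *: M q).
Proof.
move=> sf sM k l; under eq_fun do rewrite mxE.
exact: smooth_in_mul.
Qed.

Lemma mx_smoothM M (N : T -> 'M[R]_(s, t)) : mx_smooth i D M -> mx_smooth i D N ->
  mx_smooth i D (fun q => M q *m N q).
Proof.
move=> sM sN k l; under eq_fun do rewrite mxE.
by apply: smooth_in_sum => // a; exact: smooth_in_mul.
Qed.

Lemma mx_smooth_tr M : mx_smooth i D M -> mx_smooth i D (fun q => (M q)^T).
Proof. by move=> sM k l; under eq_fun do rewrite mxE; exact: sM. Qed.

Lemma mx_smooth_pd a M : mx_smooth i D M -> mx_smooth i D (mpd i a M).
Proof.
by move=> sM k l; under eq_fun do rewrite mxE; exact: smooth_in_pd.
Qed.

End Closure.

Lemma smooth_in_det r (M : T -> 'M[R]_r) : mx_smooth i D M ->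
  smooth_in i D (fun q => \det (M q)).
Proof.
move=> sM; apply: smooth_in_sum => // s; apply: smooth_in_mul => //.
  exact: smooth_in_cst.
by apply: smooth_in_prod => // a.
Qed.

(** Cramer's rule: the entries are cofactors divided by a determinant that does not vanish on
    [D]. *)
Lemma mx_smooth_inv r (M : T -> 'M[R]_r) : mx_smooth i D M ->
  (forall q, D q -> dom A i q -> M q \in unitmx) ->
  mx_smooth i D (fun q => invmx (M q)).
Proof.
move=> sM uM k l.
have s1 : smooth_in i D (fun q => (\det (M q))^-1 * cofactor (M q) l k).
  apply: smooth_in_mul => //.
    apply: smooth_in_inv => //; last exact: smooth_in_det.
    by move=> q Dq dq; have := uM q Dq dq; rewrite unitmxE unitfE.
  apply: smooth_in_mul => //; first exact: smooth_in_cst.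
  apply: smooth_in_det => a b; under eq_fun do rewrite !mxE.
  exact: sM.
apply: smooth_in_eq s1 => // q Dq dq.
by rewrite /invmx uM// !mxE.
Qed.

Lemma mx_smooth_block r1 r2 s1 s2 (M1 : T -> 'M[R]_(r1, s1))
   (M2 : T -> 'M[R]_(r1, s2)) (M3 : T -> 'M[R]_(r2, s1)) (M4 : T -> 'M[R]_(r2, s2)) :
  mx_smooth i D M1 -> mx_smooth i D M2 -> mx_smooth i D M3 -> mx_smooth i D M4 ->
  mx_smooth i D (fun q => block_mx (M1 q) (M2 q) (M3 q) (M4 q)).
Proof.
move=> h1 h2 h3 h4 k l.
rewrite -[k]splitK -[l]splitK; case: (fintype.split k) => k'; case: (fintype.split l) => l' /=.
- by under eq_fun do rewrite block_mxEul; exact: h1.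
- by under eq_fun do rewrite block_mxEur; exact: h2.
- by under eq_fun do rewrite block_mxEdl; exact: h3.
- by under eq_fun do rewrite block_mxEdr; exact: h4.
Qed.

Lemma mx_smooth_row r s1 s2 (M1 : T -> 'M[R]_(r, s1)) (M2 : T -> 'M[R]_(r, s2)) :
  mx_smooth i D M1 -> mx_smooth i D M2 ->
  mx_smooth i D (fun q => row_mx (M1 q) (M2 q)).
Proof.
move=> h1 h2 k l; rewrite -[l]splitK; case: (fintype.split l) => l' /=.
- by under eq_fun do rewrite row_mxEl; exact: h1.
- by under eq_fun do rewrite row_mxEr; exact: h2.
Qed.

Lemma mpd_cst a r s (c : 'M[R]_(r, s)) p : mpd i a (fun=> c) p = 0.
Proof. by apply/matrixP => k l; rewrite !mxE pd_cst. Qed.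

Lemma mpd_tr a r s (M : T -> 'M[R]_(r, s)) p :
  mpd i a (fun q => (M q)^T) p = (mpd i a M p)^T.
Proof. by apply/matrixP => k l; rewrite !mxE; under eq_fun do rewrite mxE. Qed.

Lemma mpd_block a r1 r2 s1 s2 (M1 : T -> 'M[R]_(r1, s1))
   (M2 : T -> 'M[R]_(r1, s2)) (M3 : T -> 'M[R]_(r2, s1)) (M4 : T -> 'M[R]_(r2, s2)) p :
  mpd i a (fun q => block_mx (M1 q) (M2 q) (M3 q) (M4 q)) p =
  block_mx (mpd i a M1 p) (mpd i a M2 p) (mpd i a M3 p) (mpd i a M4 p).
Proof.
apply/matrixP => k l; rewrite mxE.
rewrite -[k]splitK -[l]splitK; case: (fintype.split k) => k'; case: (fintype.split l) => l' /=.
- by rewrite block_mxEul mxE; under eq_fun do rewrite block_mxEul.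
- by rewrite block_mxEur mxE; under eq_fun do rewrite block_mxEur.
- by rewrite block_mxEdl mxE; under eq_fun do rewrite block_mxEdl.
- by rewrite block_mxEdr mxE; under eq_fun do rewrite block_mxEdr.
Qed.

Variable p : T.
Hypotheses (Dp : D p) (dp : dom A i p).
Variable a : 'I_n.

Lemma mpd_eq r s (M N : T -> 'M[R]_(r, s)) :
  (forall q, D q -> dom A i q -> M q = N q) -> mpd i a M p = mpd i a N p.
Proof.
move=> MN; apply/matrixP => k l; rewrite !mxE.
by apply: (pd_eq cA oD) => // q Dq dq; rewrite MN.
Qed.

Lemma mpdD r s (M N : T -> 'M[R]_(r, s)) : mx_smooth i D M -> mx_smooth i D N ->
  mpd i a (fun q => M q + N q) p = mpd i a M p + mpd i a N p.
Proof.
move=> sM sN; apply/matrixP => k l; rewrite !mxE; under eq_fun do rewrite mxE.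
exact: (pdD Dp dp a (sM k l) (sN k l)).
Qed.

Lemma mpdZ r s f (M : T -> 'M[R]_(r, s)) : smooth_in i D f -> mx_smooth i D M ->
  mpd i a (fun q => f q *: M q) p = pd i a f p *: M p + f p *: mpd i a M p.
Proof.
move=> sf sM; apply/matrixP => k l; rewrite !mxE; under eq_fun do rewrite mxE.
exact: (pdM cA Dp dp a sf (sM k l)).
Qed.

Lemma mpdM r s t (M : T -> 'M[R]_(r, s)) (N : T -> 'M[R]_(s, t)) :
  mx_smooth i D M -> mx_smooth i D N ->
  mpd i a (fun q => M q *m N q) p = mpd i a M p *m N p + M p *m mpd i a N p.
Proof.
move=> sM sN; apply/matrixP => k l; rewrite !mxE; under eq_fun do rewrite mxE.
rewrite (pd_sum cA oD) => [|//|//|b]; last exact: (smooth_in_mul cA oD).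
rewrite -big_split/=; apply: eq_bigr => b _.
by rewrite (pdM cA Dp dp a (sM k b) (sN b l)) !mxE.
Qed.

Lemma mpd_sum r s (I : Type) (e : seq I) (F : I -> T -> 'M[R]_(r, s)) :
  (forall b, mx_smooth i D (F b)) ->
  mpd i a (fun q => \sum_(b <- e) F b q) p = \sum_(b <- e) mpd i a (F b) p.
Proof.
move=> sF; apply/matrixP => k l; rewrite !mxE summxE; under eq_fun do rewrite summxE.
rewrite (pd_sum cA oD)// => [|b]; last exact: sF.
by apply: eq_bigr => b _; rewrite mxE.
Qed.

Lemma mpd_comm b r s (M : T -> 'M[R]_(r, s)) : mx_smooth i D M ->
  mpd i a (mpd i b M) p = mpd i b (mpd i a M) p.
Proof.
move=> sM; apply/matrixP => k l.
have E c d : mpd i c (mpd i d M) p k l = pd i c (pd i d (fun q => M q k l)) p.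
  rewrite [LHS]mxE.
  by have -> : (fun q => mpd i d M q k l) = pd i d (fun q => M q k l) by
    apply/funext => q; rewrite mxE.
transitivity (pd i a (pd i b (fun q => M q k l)) p); first exact (E a b).
transitivity (pd i b (pd i a (fun q => M q k l)) p); last exact (esym (E b a)).
exact (pd_comm cA oD Dp dp a b (sM k l)).
Qed.

End MatrixCalculus.

(* The Christoffel symbols as matrices: nabla_a Y = d_a Y + Y *m Gam_a. *)
Definition conn (R : realType) (n : nat) (T : topologicalType) (A : atlas R n T)
    (g : bfields A) (i : idx A) (a : 'I_n) (p : T) : 'M[R]_n :=
  \matrix_(b, k) christoffel g i p k a b.

(** The curvature form dG + G ^ G. The products stand in the order [G b], [G a] because the matrices
    act on rows from the right. The directions [a], [b] are coordinate directions, while the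
    matrices may be taken with respect to any frame. *)
Definition conn_curv (R : realType) (n : nat) (T : topologicalType)
    (A : atlas R n T) (i : idx A) (r : nat) (G : 'I_n -> T -> 'M[R]_r)
    (a b : 'I_n) (p : T) : 'M[R]_r :=
  mpd i a (G b) p - mpd i b (G a) p + G b p *m G a p - G a p *m G b p.

(* Derivatives are limits: comparing two of them by unfolding does not end. *)
#[local] Opaque pd mpd.

(* Decides identities that hold in the free abelian group on the products and
   derivatives occurring in them. *)
Ltac mx_ring :=
  repeat match goal with
  | |- context [@mulmx ?R ?m ?n ?p ?A ?B] =>
      let X := fresh "X" in set X := (@mulmx R m n p A B); clearbody X
  end;
  repeat match goal with
  | |- context [@mpd ?R ?n ?T ?A ?i ?a ?r ?s ?M ?p] =>
      let X := fresh "X" in set X := (@mpd R n T A i a r s M p); clearbody X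
  end;
  apply/matrixP => ? ?; rewrite !mxE; ring.

(** * Levi-Civita connection and curvature in terms of matrices *)

Section LeviCivita.
Variables (R : realType) (n : nat) (T : topologicalType) (A : atlas R n T).
Variables (g : bfields A) (i : idx A) (p : T).
Hypotheses (gT : (g i p)^T = g i p) (gu : g i p \in unitmx).
Hypothesis dgT : forall a, (mpd i a (g i) p)^T = mpd i a (g i) p.

(** Twice the Christoffel symbols of the first kind. *)
Let lowered a : 'M[R]_n := \matrix_(b, l)
  (pd i a (fun q => g i q b l) p + pd i b (fun q => g i q a l) p
   - pd i l (fun q => g i q a b) p).

Let connM a : conn g i a p *m g i p = 2^-1 *: lowered a.
Proof.
have -> : conn g i a p = 2^-1 *: (lowered a *m invmx (g i p)).
  apply/matrixP => b k; rewrite !mxE; congr (_ * _); apply: eq_bigr => l _.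
  rewrite !mxE mulrC; congr (_ * _).
  by rewrite -[in RHS]gT -trmx_inv mxE.
by rewrite -scalemxAl mulmxKV.
Qed.

Let dg_sym a b c : pd i a (fun q => g i q b c) p = pd i a (fun q => g i q c b) p.
Proof. by have /matrixP/(_ b c) := dgT a; rewrite !mxE. Qed.

Lemma conn_torsion_free a b :
  delta_mx 0 b *m conn g i a p = delta_mx 0 a *m conn g i b p :> 'rV[R]_n.
Proof.
apply: (can_inj (mulmxK gu)); rewrite -!mulmxA !connM -!scalemxAr -!rowE.
apply/rowP => l; rewrite !mxE; congr (_ * (_ - _)).
  exact: addrC.
by rewrite dg_sym.
Qed.

Lemma conn_metric a :
  mpd i a (g i) p = conn g i a p *m g i p + (conn g i a p *m g i p)^T.
Proof.
rewrite connM; apply/matrixP => b c; rewrite !mxE.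
by rewrite (dg_sym a c b); field.
Qed.

(** Koszul's argument. For S_c = G_c g, torsion freeness makes S_cdl symmetric in c and d, and
    compatibility reads d_c g_bl = S_cbl + S_clb; in the combination defining [lowered] everything
    cancels except 2 S_abl. This is how a guessed connection gets identified. *)
Lemma conn_unique (G : 'I_n -> 'M[R]_n) :
  (forall a b, delta_mx 0 b *m G a = delta_mx 0 a *m G b :> 'rV[R]_n) ->
  (forall a, mpd i a (g i) p = G a *m g i p + (G a *m g i p)^T) ->
  forall a, conn g i a p = G a.
Proof.
move=> Gs Gm a; apply: (can_inj (mulmxK gu)); rewrite connM.
pose S c := G c *m g i p.
have Ss c d l : S c d l = S d c l.
  have /rowP/(_ l) : row d (S c) = row c (S d) by rewrite !rowE !mulmxA Gs.
  by rewrite !mxE.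
have dgS c b l : pd i c (fun q => g i q b l) p = S c b l + S c l b.
  have symE (M : 'M[R]_n) : (M + M^T) b l = M b l + M l b by rewrite !mxE.
  by rewrite -symE /S -Gm mxE.
rewrite -/(S a); move: (S) Ss dgS => {}S Ss dgS.
apply/matrixP => b l; rewrite !(mxE, dgS).
rewrite (Ss l a b) (Ss l b a) (Ss b a l).

by field.
Qed.

End LeviCivita.

Section Curvature.
Variables (R : realType) (n : nat) (T : topologicalType) (A : atlas R n T).
Hypothesis cA : charted A.
Variables (i : idx A) (D : set T).
Hypothesis oD : open D.
Variable p : T.
Hypotheses (Dp : D p) (dp : dom A i p).

Lemma nabla_conn (g : bfields A) (X Y : vfields A) q :
  nabla g X Y i q =
  \sum_a X i q 0 a *: (mpd i a (Y i) q + Y i q *m conn g i a q).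
Proof.
apply/rowP => k; rewrite mxE summxE /der -big_split/=; apply: eq_bigr => a _.
rewrite !mxE mulrDr; congr (_ + _); rewrite mulr_sumr; apply: eq_bigr => b _.
by rewrite mxE -mulrA mulrC -mulrA.
Qed.

Lemma mx_smooth_conn (g : bfields A) a : mx_smooth i D (g i) ->
  (forall q, D q -> dom A i q -> g i q \in unitmx) ->
  mx_smooth i D (conn g i a).
Proof.
move=> sg ug b k.
have sig : mx_smooth i D (fun q => invmx (g i q)) by exact: mx_smooth_inv.
under eq_fun do rewrite mxE.
have opp f : smooth_in i D f -> smooth_in i D (fun q => - f q).
  move=> sf; have -> : (fun q => - f q) = (fun q => -1 * f q).
    by apply/funext => q; rewrite mulN1r.
  by apply: smooth_in_mul => //; exact: smooth_in_cst.
apply: smooth_in_mul => //; first exact: smooth_in_cst.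
apply: smooth_in_sum => // l; apply: smooth_in_mul => //.
by do ![apply: smooth_in_add => //|apply: opp]; exact: smooth_in_pd.
Qed.

(** The Ricci identity: the second derivatives of [Z] cancel by Schwarz, and the mixed terms cancel
    in pairs. *)
Lemma conn_commutator r (G : 'I_n -> T -> 'M[R]_r) (Z : T -> 'rV[R]_r)
    (P := fun b q => mpd i b Z q + Z q *m G b q) a b :
  mx_smooth i D Z -> (forall c, mx_smooth i D (G c)) ->
  mpd i a (P b) p + P b p *m G a p - (mpd i b (P a) p + P a p *m G b p) =
  Z p *m conn_curv i G a b p.
Proof.
move=> sZ sG.
have dP c d : mpd i c (P d) p = mpd i c (mpd i d Z) p +
    (mpd i c Z p *m G d p + Z p *m mpd i c (G d) p).
  rewrite (mpdD Dp dp); [|exact: mx_smooth_pd|exact: mx_smoothM].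
  by rewrite (mpdM cA oD Dp dp).
rewrite (dP a b) (dP b a) (mpd_comm cA oD Dp dp a b sZ) /conn_curv /P.
rewrite (mulmxBr (Z p)) (mulmxDr (Z p)) (mulmxBr (Z p)).
rewrite (mulmxDl (mpd i b Z p)) (mulmxDl (mpd i a Z p)) !mulmxA.
mx_ring.
Qed.

(** The algebra behind tensoriality of the curvature. Here [x], [y] are the components of X, Y, [u]
    and [v] the derivatives of those of Y and X, [P b] is nabla_b Z and [Q a b] is nabla_a nabla_b
    Z; the third sum is the Lie bracket term. *)
Lemma commutator_sum (V : lmodType R) (x y : 'I_n -> R) (u v : 'I_n -> 'I_n -> R)
    (P : 'I_n -> V) (Q : 'I_n -> 'I_n -> V) :
  \sum_a \sum_b ((x a * u a b) *: P b + (x a * y b) *: Q a b)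
  - \sum_a \sum_b ((y a * v a b) *: P b + (y a * x b) *: Q a b)
  - \sum_a \sum_b ((x a * u a b) *: P b - (y a * v a b) *: P b) =
  \sum_a \sum_b (x a * y b) *: (Q a b - Q b a).
Proof.
have -> : \sum_a \sum_b ((y a * v a b) *: P b + (y a * x b) *: Q a b) =
    \sum_a \sum_b ((y a * v a b) *: P b + (x a * y b) *: Q b a).
  have split_sum (w : 'I_n -> 'I_n -> V) : \sum_a \sum_b ((y a * v a b) *: P b + w a b) =
      \sum_a \sum_b (y a * v a b) *: P b + \sum_a \sum_b w a b.
    by rewrite -big_split; apply: eq_bigr => a _; rewrite big_split.
  rewrite !split_sum; congr (_ + _); rewrite exchange_big.
  by apply: eq_bigr => a _; apply: eq_bigr => b _; rewrite mulrC.
rewrite -!sumrB; apply: eq_bigr => a _; rewrite -!sumrB; apply: eq_bigr => b _.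
have cancel (p1 q1 v1 q2 : V) : p1 + q1 - (v1 + q2) - (p1 - v1) = q1 - q2.
  by rewrite [in X in X - _]opprD [X in X - _]addrACA [LHS]addrAC subrr add0r.
by rewrite cancel scalerBr.
Qed.

Lemma curv_conn (g : bfields A) (X Y Z : vfields A) :
  mx_smooth i D (X i) -> mx_smooth i D (Y i) -> mx_smooth i D (Z i) ->
  (forall a, mx_smooth i D (conn g i a)) ->
  curv g X Y Z i p = \sum_a \sum_b
    (X i p 0 a * Y i p 0 b) *: (Z i p *m conn_curv i (conn g i) a b p).
Proof.
move=> sX sY sZ sG.
pose P b q := mpd i b (Z i) q + Z i q *m conn g i b q.
have sP b : mx_smooth i D (P b).
  by apply: mx_smoothD => //; [exact: mx_smooth_pd|exact: mx_smoothM].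
pose D2 a b := mpd i a (P b) p + P b p *m conn g i a p.
have nabla2 X' Y' : mx_smooth i D (Y' i) -> nabla g X' (nabla g Y' Z) i p =
    \sum_a \sum_b ((X' i p 0 a * pd i a (fun q => Y' i q 0 b) p) *: P b p +
                   (X' i p 0 a * Y' i p 0 b) *: D2 a b).
  move=> sY'; rewrite nabla_conn; apply: eq_bigr => a _.
  have -> : nabla g Y' Z i = fun q => \sum_b Y' i q 0 b *: P b q.
    by apply/funext => q; rewrite nabla_conn.
  rewrite (mpd_sum cA oD Dp dp) => [|b]; last by apply: mx_smoothZ.
  rewrite mulmx_suml -big_split/= scaler_sumr; apply: eq_bigr => b _.
  rewrite (mpdZ cA Dp dp a (sY' 0 b) (sP b)) -scalemxAl -addrA scalerDr scalerA.
  by rewrite -scalerDr scalerA.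
have nlie : nabla g (lie X Y) Z i p =
    \sum_a \sum_b ((X i p 0 a * pd i a (fun q => Y i q 0 b) p) *: P b p -
      (Y i p 0 a * pd i a (fun q => X i q 0 b) p) *: P b p).
  rewrite nabla_conn exchange_big; apply: eq_bigr => b _ /=.
  rewrite mxE /der -sumrB scaler_suml; apply: eq_bigr => a _.
  by rewrite scalerBl.
have D2K a b : D2 a b - D2 b a = Z i p *m conn_curv i (conn g i) a b p.
  by exact: conn_commutator.
rewrite /curv !nabla2// nlie commutator_sum.
by apply: eq_bigr => a _; apply: eq_bigr => b _; rewrite -D2K.
Qed.

(** The last hypothesis is the gauge law G = (dP) P^-1 + P E P^-1 multiplied by P, a form in which
    no inverse has to be differentiated. Differentiating it once and antisymmetrising removes the
    second derivatives of P. *)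
Lemma gauge_curv r (G E : 'I_n -> T -> 'M[R]_r) (P : T -> 'M[R]_r) (a b : 'I_n) :
  (forall c, mx_smooth i D (G c)) -> (forall c, mx_smooth i D (E c)) ->
  mx_smooth i D P ->
  (forall c q, D q -> dom A i q -> G c q *m P q = mpd i c P q + P q *m E c q) ->
  conn_curv i G a b p *m P p = P p *m conn_curv i E a b p.
Proof.
move=> sG sE sP GE.
have dGE c d : mpd i c (G d) p *m P p + G d p *m mpd i c P p =
    mpd i c (mpd i d P) p + (mpd i c P p *m E d p + P p *m mpd i c (E d) p).
  rewrite -(mpdM cA oD)// -(mpdM cA oD)//.
  rewrite -(mpdD Dp dp)//; [|exact: mx_smooth_pd|exact: mx_smoothM].
  by apply: (mpd_eq cA oD) => // q Dq dq; exact: GE.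
have dP c : mpd i c P p = G c p *m P p - P p *m E c p.
  by rewrite GE// addrK.
have dG c d : mpd i c (G d) p *m P p = mpd i c (mpd i d P) p +
    (mpd i c P p *m E d p + P p *m mpd i c (E d) p) - G d p *m mpd i c P p.
  by rewrite -dGE addrK.
rewrite /conn_curv mulmxBl mulmxDl mulmxBl mulmxBr mulmxDr mulmxBr (dG a b) (dG b a).
rewrite (mpd_comm cA oD Dp dp a b sP) !dP !mulmxBr !mulmxBl !mulmxA.
mx_ring.
Qed.

End Curvature.

Lemma conn_curvC (R : realType) n (T : topologicalType) (A : atlas R n T)
    (i : idx A) r (G : 'I_n -> T -> 'M[R]_r) a b p :
  conn_curv i G b a p = - conn_curv i G a b p.
Proof. by rewrite /conn_curv; mx_ring. Qed.

Lemma conn_curv_diag (R : realType) n (T : topologicalType) (A : atlas R n T)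
    (i : idx A) r (G : 'I_n -> T -> 'M[R]_r) a p :
  conn_curv i G a a p = 0.
Proof. by rewrite /conn_curv; mx_ring. Qed.

#[local] Opaque conn.

Section DeltaSums.
Variables (R : nzRingType) (n : nat) (V : lmodType R).

Lemma sum_delta_mx (F : 'I_n -> V) c :
  \sum_e (delta_mx 0 c : 'rV[R]_n) 0 e *: F e = F c.
Proof.
rewrite (bigD1 c)//= !mxE !eqxx scale1r big1 ?addr0// => e /negPf ec.
by rewrite !mxE ec scale0r.
Qed.

Lemma sum_delta_mx2 (F : 'I_n -> 'I_n -> V) a b :
  \sum_d \sum_e ((delta_mx 0 a : 'rV[R]_n) 0 d * (delta_mx 0 b : 'rV[R]_n) 0 e) *: F d e
  = F a b.
Proof.
rewrite -[RHS](sum_delta_mx (fun e => F a e)) -(sum_delta_mx (fun d => \sum_e _ *: F d e)).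
apply: eq_bigr => d _; rewrite scaler_sumr; apply: eq_bigr => e _.
by rewrite scalerA.
Qed.

End DeltaSums.

(** Symmetry and invertibility are what the Levi-Civita formula rests on, and they are common to the
    Riemannian metrics of F and M and to the Lorentzian metric of the cylinder. *)
Record pseudo_riemannian (R : realType) (n : nat) (T : topologicalType)
    (A : atlas R n T) (g : bfields A) : Prop := PseudoRiemannian {
  pr_smooth : forall i, mx_smooth i (dom A i) (g i);
  pr_unit : forall i p, dom A i p -> g i p \in unitmx;
  pr_sym : forall i p, dom A i p -> (g i p)^T = g i p }.

(** * Change of charts, and testing tensor identities on coordinate fields *)

Section CoordinateFields.
Variables (R : realType) (n : nat) (T : topologicalType) (A : atlas R n T).
Hypothesis cA : charted A.

Lemma smooth_in_subset (i : idx A) (D D' : set T) (f : T -> R) :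
  (forall q, D' q -> dom A i q -> D q) -> smooth_in i D f -> smooth_in i D' f.
Proof.
move=> DD'; apply: Cinfty_subset => x [q [Dq dq] <-].
by exists q => //; split=> //; exact: DD'.
Qed.

Lemma mx_smooth_subset (i : idx A) (D D' : set T) r s (M : T -> 'M[R]_(r, s)) :
  (forall q, D' q -> dom A i q -> D q) -> mx_smooth i D M -> mx_smooth i D' M.
Proof. by move=> DD' sM k l; exact: smooth_in_subset (sM k l). Qed.

Lemma smooth_in_chart (i j : idx A) D k : (forall q, D q -> dom A j q) ->
  smooth_in i D (fun q => chart A j q 0 k).
Proof.
move=> Dj; apply: (smooth_in_subset _ (ch_transition cA j k i)).
by move=> q Dq _; exact: Dj.
Qed.

Lemma smooth_in_change (i j : idx A) (D : set T) (f : T -> R) : open D ->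
  (forall q, D q -> dom A i q) -> smooth_in i D f -> smooth_in j D f.
Proof.
move=> oD Di sf.
have oV : open (chart A j @` (D `&` dom A j)) by exact: open_chart_image.
have oW : open (chart A i @` (D `&` dom A i)) by exact: open_chart_image.
have sphi k := smooth_in_chart j k Di.
have sg : Cinfty (chart A j @` (D `&` dom A j))
    ((f \o cinv A i) \o (fun x => chart A i (cinv A j x))).
  move=> k; apply: (Ck_comp oV oW) => //.
    move=> x [q [Dq dq] <-]; rewrite ch_cinvK//; exists q => //; split=> //.
    exact: Di.
  by move=> a; exact: (sphi a k).
apply: Cinfty_eq sg => // x; rewrite inE => -[q [Dq dq] <-] /=.
by rewrite [cinv A j _]ch_cinvK// ch_cinvK//; exact: Di.
Qed.

Lemma pd_change (i j : idx A) (D : set T) (f : T -> R) p a : open D ->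
  (forall q, D q -> dom A j q) -> smooth_in j D f -> D p -> dom A i p ->
  pd i a f p = \sum_b pd i a (fun q => chart A j q 0 b) p * pd j b f p.
Proof.
move=> oD Dj sf Dp dp.
have oV : open (chart A i @` (D `&` dom A i)) by exact: open_chart_image.
have oW : open (chart A j @` (D `&` dom A j)) by exact: open_chart_image.
have sphi k := smooth_in_chart i k Dj.
have Vp : (chart A i @` (D `&` dom A i)) (chart A i p) by exists p.
have Wp : (chart A j @` (D `&` dom A j)) (chart A j p).
  by exists p => //; split=> //; exact: Dj.
pose phi x := chart A j (cinv A i x).
have phip : phi (chart A i p) = chart A j p by rewrite /phi ch_cinvK.
have [_ E] : is_derive (chart A i p) (delta_mx 0 a) ((f \o cinv A j) \o phi)
  (\sum_b 'D_(delta_mx 0 a) (fun x => phi x 0 b) (chart A i p) *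
          'D_(delta_mx 0 b) (f \o cinv A j) (phi (chart A i p))).
  apply: chain_rule; rewrite ?phip.
  - apply: filterS (open_nbhs_nbhs (conj oW Wp)) => y Wy b.
    by case: (Cinfty_derive b sf Wy).
  - by move=> b; exact: Ck_continuous (Cinfty_partial b sf 0%N) Wp.
  - by move=> b; case: (Cinfty_derive a (sphi b) Vp).
rewrite phip in E; rewrite -[RHS]E; apply: near_eq_derive.
apply: filterS (open_nbhs_nbhs (conj oV Vp)) => x [q [Dq dq] <-] /=.
by rewrite /phi !ch_cinvK//; exact: Dj.
Qed.

Lemma pd_chart i p a b : dom A i p ->
  pd i a (fun q => chart A i q 0 b) p = (delta_mx 0 a : 'rV[R]_n) 0 b.
Proof.
move=> dp.
have [h|_ E] := derive_linear_comp id (L := fun y : 'rV[R]_n => y 0 b)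
    (x := chart A i p) (v := delta_mx 0 a) (w := (delta_mx 0 a : 'rV[R]_n) 0 b).
  by rewrite !mxE.
rewrite -[RHS](derive_id (chart A i p 0 b)) -[RHS]E; apply: near_eq_derive.
have : nbhs (chart A i p) (chart A i @` dom A i).
  by apply: open_nbhs_nbhs; split; [exact: ch_img_open|exists p].
by apply: filterS => x [q dq <-] /=; rewrite ch_cinvK.
Qed.

(** [flat] and [codazzi] quantify over vector fields, which carry components in every chart. These
    fields extend the basis vectors of chart [i] accordingly, so that such conditions can be turned
    into matrix identities. *)
Definition coord_field (i : idx A) (a : 'I_n) : vfields A :=
  fun j p => row a (jac i j p).

Lemma coord_fieldE i a p : dom A i p -> coord_field i a i p = delta_mx 0 a.
Proof. by move=> dp; apply/rowP => b; rewrite !mxE pd_chart// mxE. Qed.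

(** The Jacobian entries are evidently smooth in chart [i], and [smooth_in_change] carries this to
    chart [j]. The transformation law is the chain rule for Jacobians. *)
Lemma vector_field_coord i a : vector_field (dom A i) (coord_field i a).
Proof.
split=> [j k l|j k p di dj dk].
  have oD : open (dom A i `&` dom A j) by apply: openI; exact: ch_dom_open.
  apply: (smooth_in_change (i := i)) => //; first by move=> q [].
  have := smooth_in_pd cA oD a (smooth_in_chart i k (fun q (h : (dom A i `&` dom A j) q) => h.2)).
  by apply: smooth_in_eq => // q _ _; rewrite !mxE.
apply/rowP => b; rewrite !mxE.
have oD : open (dom A k `&` dom A j) by apply: openI; exact: ch_dom_open.
rewrite (pd_change a oD (fun q (h : (dom A k `&` dom A j) q) => h.2)
  (smooth_in_chart j b (fun q (h : (dom A k `&` dom A j) q) => h.1)) (conj dk dj) di).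
by apply: eq_bigr => c _; rewrite !mxE.
Qed.

Section Metric.
Variable g : bfields A.
Hypothesis mg : pseudo_riemannian g.
Let sg := pr_smooth mg.
Let ug := pr_unit mg.

Lemma mpd_metric_sym i a p : dom A i p -> (mpd i a (g i) p)^T = mpd i a (g i) p.
Proof.
move=> dp; rewrite -mpd_tr.
by apply: (mpd_eq cA (ch_dom_open cA i) dp dp) => q dq _; exact: pr_sym.
Qed.

Lemma conn_torsion i a b p : dom A i p ->
  delta_mx 0 b *m conn g i a p = delta_mx 0 a *m conn g i b p :> 'rV[R]_n.
Proof.
move=> dp; apply: conn_torsion_free; [exact: pr_sym|exact: ug|].
by move=> c; exact: mpd_metric_sym.
Qed.

Lemma conn_compatible i a p : dom A i p ->
  mpd i a (g i) p = conn g i a p *m g i p + (conn g i a p *m g i p)^T.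
Proof.
move=> dp; apply: conn_metric; [exact: pr_sym|exact: ug|].
by move=> c; exact: mpd_metric_sym.
Qed.

Lemma mx_smooth_conn_in i (D : set T) a : open D -> mx_smooth i D (conn g i a).
Proof.
move=> oD; apply: (@mx_smooth_subset i (dom A i)) => //.
apply: mx_smooth_conn => //; first exact: ch_dom_open.
by move=> q _; exact: ug.
Qed.

Lemma mx_smooth_vector_field (D : set T) (X : vfields A) i :
  vector_field D X -> mx_smooth i D (X i).
Proof.
move=> [sX _] k l; rewrite (ord1 k).
by apply: smooth_in_subset (sX i l i).
Qed.

Lemma curv_vector_field (D : set T) (X Y Z : vfields A) i p : open D ->
  vector_field D X -> vector_field D Y -> vector_field D Z ->
  D p -> dom A i p ->
  curv g X Y Z i p = \sum_a \sum_b
    (X i p 0 a * Y i p 0 b) *: (Z i p *m conn_curv i (conn g i) a b p).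
Proof.
move=> oD vX vY vZ Dp dp.
apply: (curv_conn cA oD Dp dp); try exact: mx_smooth_vector_field.
by move=> a; exact: mx_smooth_conn_in.
Qed.

(** On three coordinate fields a single term of the tensorial formula survives; conversely that
    formula vanishes term by term. *)
Lemma flat_conn : flat g <->
  forall i a b p, dom A i p -> conn_curv i (conn g i) a b p = 0.
Proof.
split=> [fg i a b p dp|K0 D X Y Z oD vX vY vZ i p Dp dp]; last first.
  rewrite (curv_vector_field oD vX vY vZ Dp dp).
  by rewrite big1// => a _; rewrite big1// => b _; rewrite K0// mulmx0 scaler0.
apply/row_matrixP => c; rewrite row0 rowE.
have oD := ch_dom_open cA i.
have := curv_vector_field oD (vector_field_coord i a) (vector_field_coord i b)
  (vector_field_coord i c) dp dp.
rewrite (coord_fieldE a dp) (coord_fieldE b dp) (coord_fieldE c dp).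
rewrite sum_delta_mx2 => <-.
exact: (fg _ _ _ _ oD (vector_field_coord i a) (vector_field_coord i b)
  (vector_field_coord i c) _ _ dp dp).
Qed.

(** On coordinate fields, (nabla_a E)(d_b) is the displayed expression minus E applied to nabla_a
    d_b, and the latter is symmetric in [a] and [b] by torsion freeness. *)
Lemma codazzi_conn (E : efields A) i a b p : codazzi g E -> dom A i p ->
  delta_mx 0 b *m (mpd i a (E i) p + E i p *m conn g i a p) =
  delta_mx 0 a *m (mpd i b (E i) p + E i p *m conn g i b p) :> 'rV[R]_n.
Proof.
move=> [[sE _] _ cE] dp.
have oD := ch_dom_open cA i.
have sEi : mx_smooth i (dom A i) (E i).
  by move=> k l; apply: smooth_in_subset (sE i k l i).
have nE c d : nablaE g (coord_field i c) E (coord_field i d) i p =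
   delta_mx 0 d *m (mpd i c (E i) p + E i p *m conn g i c p) -
   delta_mx 0 d *m conn g i c p *m E i p.
  rewrite /nablaE /eapp !nabla_conn (coord_fieldE c dp) !sum_delta_mx.
  rewrite (mpd_eq cA oD dp dp c (N := fun q => delta_mx 0 d *m E i q)); last first.
    by move=> q dq _; rewrite coord_fieldE.
  rewrite (mpd_eq cA oD dp dp c (M := coord_field i d i) (N := fun=> delta_mx 0 d)); last first.
    by move=> q dq _; exact: coord_fieldE.
  rewrite mpd_cst add0r (mpdM cA oD dp dp c (mx_smooth_cst cA i oD (delta_mx 0 d)) sEi).
  by rewrite mpd_cst mul0mx add0r coord_fieldE// mulmxDr mulmxA.
have := cE _ _ _ oD (vector_field_coord i a) (vector_field_coord i b) i p dp dp.
by rewrite !nE (conn_torsion a b dp) => /subIr.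
Qed.

End Metric.

End CoordinateFields.

(** * Products with an interval *)

#[local] Transparent pd.

Lemma open_snd (S T : topologicalType) (D : set T) :
  open D -> open [set q : S * T | D q.2].
Proof. by move=> oD; apply: open_comp => // q _; exact: cvg_snd. Qed.

Lemma open_slice (S T : topologicalType) (D : set (S * T)) t :
  open D -> open [set x | D (t, x)].
Proof.
move=> oD; apply: (@open_comp _ _ (fun x : T => (t, x))) => // x _.
exact: cvg_pair (cvg_cst t) cvg_id.
Qed.

Section LineAtlas.
Variables (R : realType) (n : nat) (T : topologicalType) (A : atlas R n T).
Hypothesis cA : charted A.
Variable J : set R.
Hypothesis oJ : open J.
Let B := line_atlas J A.
Implicit Types i j : idx A.

Let l0 : 'I_(1 + n) := lshift n 0.

Lemma line_cinv_row i (s : R) (y : 'rV[R]_n) :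
  cinv B i (row_mx s%:M y) = (s, cinv A i y).
Proof. by rewrite /= row_mxKl row_mxKr mxE eqxx. Qed.

Lemma line_image i (D : set (R * T)) : chart B i @` (D `&` dom B i) =
  [set x : 'rV[R]_(1 + n) | J (x 0 l0) /\
    exists p, [/\ D (x 0 l0, p), dom A i p & chart A i p = rsubmx x]].
Proof.
apply/seteqP; split=> [x [[s p] [Dp [/= Js dp]] <-]|x /= [Jx [p [Dp dp px]]]].
  rewrite /= row_mxEl mxE eqxx; split=> //.
  by exists p; split=> //; rewrite row_mxKr.
exists (x 0 l0, p) => //=; rewrite px -[RHS]hsubmxK; congr row_mx.
by apply/matrixP => a b; rewrite !ord1 !mxE eqxx.
Qed.

Lemma line_image_dom i : chart B i @` dom B i =
  [set x : 'rV[R]_(1 + n) | J (x 0 l0)] `&`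
  (rsubmx : 'rV[R]_(1 + n) -> 'rV[R]_n) @^-1` (chart A i @` dom A i).
Proof.
rewrite -[dom B i]setTI line_image; apply/seteqP; split=> x /=.
  by move=> [Jx [p [_ dp px]]]; split=> //; exists p.
by move=> [Jx [p dp px]]; split=> //; exists p.
Qed.

Lemma continuous_rsubmx_row (x : 'rV[R]_(1 + n)) :
  {for x, continuous (rsubmx : 'rV[R]_(1 + n) -> 'rV[R]_n)}.
Proof.
apply: continuous_rV => j.
have -> : (fun y : 'rV[R]_(1 + n) => rsubmx y 0 j) = (fun y => y 0 (rshift 1 j)).
  by apply/funext => y; rewrite mxE.
exact: coord_continuous.
Qed.

Lemma charted_line_open i : open (chart B i @` dom B i).
Proof.
rewrite line_image_dom; apply: openI.
  apply: (@open_comp _ _ (fun x : 'rV[R]_(1 + n) => x 0 l0)) => // x _.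
  exact: coord_continuous.
apply: open_comp; last exact: ch_img_open.
by move=> x _; exact: continuous_rsubmx_row.
Qed.

Lemma charted_line_cinv_cont i x :
  (chart B i @` dom B i) x -> {for x, continuous (cinv B i)}.
Proof.
rewrite line_image_dom => -[_ xA].
have c1 : {for x, continuous (fun y : 'rV[R]_(1 + n) => lsubmx y 0 0)}.
  have -> : (fun y : 'rV[R]_(1 + n) => lsubmx y 0 0) = (fun y => y 0 l0).
    by apply/funext => y; rewrite mxE.
  exact: coord_continuous.
have c2 : {for x, continuous (fun y : 'rV[R]_(1 + n) => cinv A i (rsubmx y))}.
  apply: continuous_comp; first exact: continuous_rsubmx_row.
  exact: (ch_cinv_cont cA xA).
exact: cvg_pair c1 c2.
Qed.

Lemma smooth_in_snd i (D : set T) (f : T -> R) (D' : set (R * T)) : open D ->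
  (forall q, D' q -> D q.2) -> smooth_in i D f ->
  smooth_in (A := B) i D' (fun q => f q.2).
Proof.
move=> oD DD sf.
pose W := chart A i @` (D `&` dom A i).
have oW : open W by exact: open_chart_image.
pose V := (rsubmx : 'rV[R]_(1 + n) -> 'rV[R]_n) @^-1` W.
have oV : open V.
  by apply: open_comp => // x _; exact: continuous_rsubmx_row.
have sV : Cinfty V ((f \o cinv A i) \o (rsubmx : 'rV[R]_(1 + n) -> 'rV[R]_n)).
  move=> k; apply: (Ck_comp oV oW) => // a.
  have -> : (fun y : 'rV[R]_(1 + n) => rsubmx y 0 a) = (fun y => y 0 (rshift 1 a)).
    by apply/funext => y; rewrite mxE.
  exact: Ck_coord.
apply: Cinfty_subset sV => x; rewrite line_image => -[_ [p [Dp dp px]]].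
by exists p => //; split=> //; exact: (DD _ Dp).
Qed.

Lemma smooth_in_fst i (D' : set (R * T)) : smooth_in (A := B) i D' fst.
Proof.
have sV : Cinfty setT (fun y : 'rV[R]_(1 + n) => y 0 l0).
  by move=> k; apply: Ck_coord; exact: openT.
apply: Cinfty_subset (fun _ _ => I) _ => k.
have -> : fst \o cinv B i = (fun y : 'rV[R]_(1 + n) => y 0 l0).
  by apply/funext => y; rewrite /= mxE.
exact: sV.
Qed.

Lemma smooth_in_expR i (D' : set (R * T)) (c : R) :
  smooth_in (A := B) i D' (fun q => expR (c * q.1)).
Proof.
have sV : Cinfty setT (fun y : 'rV[R]_(1 + n) => expR (c * y 0 l0)).
  by move=> k; apply: Ck_expR; exact: openT.
apply: Cinfty_subset (fun _ _ => I) _ => k.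
have -> : (fun q : R * T => expR (c * q.1)) \o cinv B i =
    (fun y : 'rV[R]_(1 + n) => expR (c * y 0 l0)).
  by apply/funext => y; rewrite /= mxE.
exact: sV.
Qed.

Lemma charted_line : charted B.
Proof.
split.
- move=> i; apply: openI; apply: open_comp => //.
  + by move=> q _; exact: cvg_fst.
  + by move=> q _; exact: cvg_snd.
  + exact: ch_dom_open.
- exact: charted_line_open.
- move=> i [s p] [/= _ dp]; rewrite row_mxKl row_mxKr mxE eqxx mulr1n.
  by rewrite ch_cinvK.
- exact: charted_line_cinv_cont.
- move=> j k i; rewrite -[k]splitK; case: (fintype.split k) => k' /=.
    have -> : (fun q : R * T => row_mx (q.1)%:M (chart A j q.2) 0 (lshift n k')) = fst.
      by apply/funext => q; rewrite row_mxEl ord1 mxE eqxx.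
    exact: smooth_in_fst.
  have -> : (fun q : R * T => row_mx (q.1)%:M (chart A j q.2) 0 (rshift 1 k')) =
      (fun q => chart A j q.2 0 k').
    by apply/funext => q; rewrite row_mxEr.
  apply: (@smooth_in_snd i (dom A j) (fun p => chart A j p 0 k')).
  + exact: ch_dom_open.
  + by move=> q [].
  + exact: ch_transition.
Qed.

Lemma smooth_in_slice i (D : set (R * T)) (f : R * T -> R) t : open D -> J t ->
  smooth_in (A := B) i D f ->
  smooth_in i [set x | D (t, x)] (fun x => f (t, x)).
Proof.
move=> oD Jt sf.
have oDt : open [set x | D (t, x)] by exact: open_slice.
have oV : open (chart A i @` ([set x | D (t, x)] `&` dom A i)) by exact: open_chart_image.
have oW : open (chart B i @` (D `&` dom B i)) by apply: open_chart_image => //; exact: charted_line.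
have sV : Cinfty (chart A i @` ([set x | D (t, x)] `&` dom A i))
    ((f \o cinv B i) \o (fun y : 'rV[R]_n => row_mx t%:M y)).
  move=> k; apply: (Ck_comp oV oW) => // [y [p [Dp dp] <-]|a].
    by exists (t, p).
  rewrite -[a]splitK; case: (fintype.split a) => a' /=.
    have -> : (fun y : 'rV[R]_n => row_mx t%:M y 0 (lshift n a')) = (fun=> t%:M 0 a').
      by apply/funext => y; rewrite row_mxEl.
    exact: Ck_cst.
  have -> : (fun y : 'rV[R]_n => row_mx t%:M y 0 (rshift 1 a')) = (fun y => y 0 a').
    by apply/funext => y; rewrite row_mxEr.
  exact: Ck_coord.
apply: Cinfty_eq sV => // y _.
by have /(congr1 f) := line_cinv_row i t y.
Qed.

Lemma pd_slice i a (f : R * T -> R) q :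
  pd (A := B) i (rshift 1 a) f q = pd i a (fun x => f (q.1, x)) q.2.
Proof.
have [h|_ E] := derive_linear_comp (f \o cinv B i)
    (L := fun y : 'rV[R]_n => (row_mx q.1%:M y : 'rV[R]_(1 + n)))
    (x := chart A i q.2) (v := delta_mx 0 a) (w := delta_mx 0 (rshift 1 a)).
  by rewrite delta_mx_rshift scale_row_mx add_row_mx scaler0 add0r.
rewrite /pd -[LHS]E; congr (derive _ _ _); apply/funext => y.
by have /(congr1 f) := line_cinv_row i q.1 y.
Qed.

Lemma pd_line i (f : R * T -> R) q : dom A i q.2 ->
  pd (A := B) i l0 f q = 'D_1 (fun s => f (s, q.2)) q.1.
Proof.
move=> dq.
have [_ E] := derive_line (f \o cinv B i) (row_mx 0 (chart A i q.2)) (delta_mx 0 l0) q.1.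
have pt s : row_mx s%:M (chart A i q.2) =
    row_mx 0 (chart A i q.2) + s *: delta_mx 0 l0 :> 'rV[R]_(1 + n).
  rewrite /l0 delta_mx_lshift scale_row_mx scaler0 add_row_mx add0r addr0.
  by congr row_mx; apply/matrixP => a b; rewrite !ord1 !mxE eqxx mulr1.
rewrite /pd [chart B i q]pt [LHS]E.
have -> // : (fun s => (f \o cinv B i) (row_mx 0 (chart A i q.2) + s *: delta_mx 0 l0)) =
  (fun s => f (s, q.2)).
apply/funext => s; rewrite -pt.
by have /(congr1 f) := line_cinv_row i s (chart A i q.2); rewrite ch_cinvK.
Qed.

End LineAtlas.

#[local] Opaque pd.

(** * Warped products along a line *)

Lemma unitmx_block_diag (R : realType) m n (a : 'M[R]_m) (b : 'M[R]_n) :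
  a \in unitmx -> b \in unitmx -> block_mx a 0 0 b \in unitmx.
Proof. by rewrite !unitmxE det_ublock => ? ?; rewrite unitrM; apply/andP. Qed.

Section LineMatrices.
Variables (R : realType) (n : nat) (T : topologicalType) (A : atlas R n T).
Hypothesis cA : charted A.
Variable J : set R.
Hypothesis oJ : open J.
Let B := line_atlas J A.

Lemma mx_smooth_snd_in (i : idx A) (D : set T) (D' : set (R * T)) r s
    (M : T -> 'M[R]_(r, s)) : open D -> (forall q, D' q -> D q.2) ->
  mx_smooth i D M -> mx_smooth (A := B) i D' (fun q => M q.2).
Proof.
by move=> oD DD sM k l; exact: (smooth_in_snd cA J oD DD (sM k l)).
Qed.

Lemma mx_smooth_snd (i : idx A) r s (M : T -> 'M[R]_(r, s)) :
  mx_smooth i (dom A i) M -> mx_smooth (A := B) i (dom B i) (fun q => M q.2).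
Proof.
by move=> sM; apply: mx_smooth_snd_in sM; [exact: ch_dom_open|move=> q []].
Qed.

Lemma mpd_slice (i : idx A) a r s (M : R * T -> 'M[R]_(r, s)) q :
  mpd (A := B) i (rshift 1 a) M q = mpd i a (fun x => M (q.1, x)) q.2.
Proof. by apply/matrixP => k l; rewrite !mxE pd_slice. Qed.

Lemma mpd_line_snd (i : idx A) r s (M : T -> 'M[R]_(r, s)) q : dom B i q ->
  mpd (A := B) i (lshift n 0) (fun q => M q.2) q = 0.
Proof.
move=> [_ dq]; apply/matrixP => k l; rewrite !mxE (pd_line cA J _ dq).
exact: (derive_cst (M q.2 k l) q.1 1).
Qed.

End LineMatrices.

(* The warped product is the case E = 1, lam = -2, w = exp (-4s), eps = 1, and
   the cylinder the case E = H_t, lam = 0, w = 1, eps = -1.  The factor 2 * eps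
   in warp_conn is forced by compatibility with the metric. *)
Section Warp.
Variables (R : realType) (n : nat) (T : topologicalType) (A : atlas R n T).
Hypothesis cA : charted A.
Variable J : set R.
Hypothesis oJ : open J.
Let B := line_atlas J A.
Let l0 : 'I_(1 + n) := lshift n 0.
Let rs (a : 'I_n) : 'I_(1 + n) := rshift 1 a.

Variables (g : bfields A) (gt : bfields B) (E : idx A -> R * T -> 'M[R]_n).
Variables (w : R * T -> R) (lam eps : R).
Hypothesis mg : pseudo_riemannian g.
Hypothesis sE : forall i, mx_smooth (A := B) i (dom B i) (E i).
Hypothesis uE : forall i q, dom B i q -> E i q \in unitmx.
Hypothesis symE : forall i q, dom B i q ->
  E i q *m g i q.2 = g i q.2 *m (E i q)^T.
Hypothesis codE : forall i a b q, dom B i q ->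
  delta_mx 0 b *m (mpd (A := B) i (rs a) (E i) q + E i q *m conn g i a q.2) =
  delta_mx 0 a *m (mpd (A := B) i (rs b) (E i) q + E i q *m conn g i b q.2)
    :> 'rV[R]_n.
Hypothesis dE : forall i q, dom B i q ->
  mpd (A := B) i l0 (E i) q + lam *: E i q = (- 2)%:M.
Hypothesis sw : forall i, smooth_in (A := B) i (dom B i) w.
Hypothesis w0 : forall q, w q != 0.
Hypothesis dw0 : forall i q, dom B i q -> pd (A := B) i l0 w q = 2 * lam * w q.
Hypothesis dwa : forall i a q, dom B i q -> pd (A := B) i (rs a) w q = 0.
Hypothesis eps2 : eps * eps = 1.
Hypothesis gtE : forall i q, dom B i q ->
  gt i q = block_mx eps%:M 0 0 (w q *: (E i q *m g i q.2 *m (E i q)^T)).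

Let cB : charted B := charted_line cA oJ.
Let oB i : open (dom B i) := ch_dom_open cB i.
Let sg i : mx_smooth (A := B) i (dom B i) (fun q => g i q.2).
Proof. exact: mx_smooth_snd (pr_smooth mg i). Qed.
Let sconn i a : mx_smooth (A := B) i (dom B i) (fun q => conn g i a q.2).
Proof. by apply: mx_smooth_snd => //; exact: (mx_smooth_conn_in cA mg _ _ (ch_dom_open cA i)). Qed.

(** Right multiplication turns coordinate components of a vector into its components in the frame
    formed by the unit field of the line and the E^-1 d_a. *)
Definition warp_gauge (i : idx B) (q : R * T) : 'M[R]_(1 + n) :=
  block_mx 1%:M 0 0 (E i q).

(** The Gram matrix of [gt] in that frame: [E] is absorbed by the gauge and only the factor [w]
    remains. *)
Let ghat (i : idx B) (q : R * T) : 'M[R]_(1 + n) :=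
  block_mx eps%:M 0 0 (w q *: g i q.2).

(* The Levi-Civita connection of gt in the frame warp_gauge. *)
Definition warp_conn (i : idx B) (m : 'I_(1 + n)) (q : R * T) : 'M[R]_(1 + n) :=
  match fintype.split m with
  | inl _ => block_mx 0 0 0 lam%:M
  | inr a => block_mx 0 (- 2 *: delta_mx 0 a)
      (w q *: (g i q.2 *m (2 * eps *: (delta_mx 0 a)^T))) (conn g i a q.2)
  end.

Let warp_conn0 i q : warp_conn i l0 q = block_mx 0 0 0 lam%:M.
Proof. by rewrite /warp_conn /l0 (unsplitK (inl _)). Qed.

Let warp_connS i a : warp_conn i (rs a) = fun q => block_mx 0 (- 2 *: delta_mx 0 a)
      (w q *: (g i q.2 *m (2 * eps *: (delta_mx 0 a)^T))) (conn g i a q.2).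
Proof. by apply/funext => q; rewrite /warp_conn /rs (unsplitK (inr _)). Qed.

Let mx_smooth_warp_conn i m : mx_smooth (A := B) i (dom B i) (warp_conn i m).
Proof.
rewrite /warp_conn; case: (fintype.split m) => a.
  exact: mx_smooth_cst.
apply: mx_smooth_block => //; try exact: mx_smooth_cst.
apply: mx_smoothZ => //; apply: mx_smoothM => //; exact: mx_smooth_cst.
Qed.

Let mx_smooth_gauge i : mx_smooth (A := B) i (dom B i) (warp_gauge i).
Proof. by apply: mx_smooth_block => //; exact: mx_smooth_cst. Qed.

Let mx_smooth_ghat i : mx_smooth (A := B) i (dom B i) (ghat i).
Proof.
by apply: mx_smooth_block => //; try exact: mx_smooth_cst; exact: mx_smoothZ.
Qed.

Let gtG i q : dom B i q -> gt i q = warp_gauge i q *m ghat i q *m (warp_gauge i q)^T.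
Proof.
move=> dq; rewrite gtE// /warp_gauge /ghat tr_block_mx !mulmx_block.
rewrite !(trmx0, mulmx0, mul0mx, addr0, add0r) trmx1 mul1mx mulmx1.
by rewrite -scalemxAr -scalemxAl.
Qed.

Lemma unitmx_warp_gauge i q : dom B i q -> warp_gauge i q \in unitmx.
Proof. by move=> dq; apply: unitmx_block_diag; [exact: unitmx1|exact: uE]. Qed.

Lemma pseudo_riemannian_warp : pseudo_riemannian gt.
Proof.
split=> [i|i q dq|i q dq].
- have s : mx_smooth (A := B) i (dom B i)
      (fun q => warp_gauge i q *m ghat i q *m (warp_gauge i q)^T).
    by apply: mx_smoothM => //; [exact: mx_smoothM|exact: mx_smooth_tr].
  by apply: mx_smooth_eq s => // q dq _; rewrite gtG.
- rewrite gtG// !unitmx_mul unitmx_tr unitmx_warp_gauge// andbT /=.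
  apply: unitmx_block_diag.
    rewrite unitmxE det_scalar1 unitfE; apply/eqP => e0.
    by have /eqP := eps2; rewrite e0 mul0r eq_sym oner_eq0.
  by rewrite unitmxZ ?unitfE//; apply: (pr_unit mg); case: dq.
- rewrite gtE// tr_block_mx !trmx0 tr_scalar_mx linearZ/= !trmx_mul trmxK.
  by rewrite (pr_sym mg (proj2 dq)) mulmxA.
Qed.

(** Along the line this is dw = 2 lam w. Along a slice the diagonal block is compatibility for [g],
    and the off-diagonal blocks cancel since 2 eps * eps = 2. *)
Lemma mpd_ghat i m q : dom B i q ->
  mpd (A := B) i m (ghat i) q =
  warp_conn i m q *m ghat i q + (warp_conn i m q *m ghat i q)^T.
Proof.
move=> dq; have [_ dq2] := dq.
have gT := pr_sym mg dq2.
rewrite /ghat (mpd_block (A := B)) !mpd_cst (mpdZ cB dq dq) //.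
rewrite -[m]splitK; case: (fintype.split m) => a.
  rewrite (ord1 a) -/l0 warp_conn0 dw0// mpd_line_snd// scaler0 addr0.
  rewrite mulmx_block !(mulmx0, mul0mx, addr0, add0r) tr_block_mx !trmx0 add_block_mx.
  rewrite !addr0 mul_scalar_mx !linearZ/= gT -scalerDr -scalerDl scalerA.
  by congr block_mx; congr (_ *: _); ring.
rewrite -/(rs a) warp_connS dwa// scale0r add0r mpd_slice conn_compatible//.
rewrite mulmx_block !(mulmx0, mul0mx, addr0, add0r) tr_block_mx add_block_mx.
rewrite !trmx0 !addr0 !mul_mx_scalar !linearZ/= !trmx_mul !linearZ/= trmxK gT.
have e2 : 2 * eps * eps = 2 by rewrite -mulrA eps2 mulr1.
rewrite -(scalemxAl (- 2)) -!(scalerDr (w q)) !(scalerA (2 * eps)) e2.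
by rewrite -!scalerDl addNr subrr !scale0r scaler0.
Qed.

Let N i m q := mpd (A := B) i m (warp_gauge i) q + warp_gauge i q *m warp_conn i m q.

Let N0 i q : dom B i q -> N i l0 q = block_mx 0 0 0 (- 2)%:M.
Proof.
move=> dq; rewrite /N /warp_gauge (mpd_block (A := B)) !mpd_cst warp_conn0.
rewrite mulmx_block !(mulmx0, mul0mx, addr0, add0r) add_block_mx !addr0.
by rewrite mul_mx_scalar dE.
Qed.

Let NS i a q : N i (rs a) q = block_mx 0 (- 2 *: delta_mx 0 a)
  (E i q *m (w q *: (g i q.2 *m (2 * eps *: (delta_mx 0 a)^T))))
  (mpd (A := B) i (rs a) (E i) q + E i q *m conn g i a q.2).
Proof.
rewrite /N /warp_gauge (mpd_block (A := B)) !mpd_cst warp_connS.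
by rewrite mulmx_block !(mulmx0, mul0mx, addr0, add0r) add_block_mx !add0r mul1mx.
Qed.

(** Each kind of entry uses one hypothesis: [dE] matches the entry -2 when one direction is the
    line, [codE] handles the slice components, and [symE] makes the component along the line
    symmetric in [a] and [b]. *)
Lemma warp_torsion_free i m k q : dom B i q ->
  delta_mx 0 k *m N i m q = delta_mx 0 m *m N i k q :> 'rV[R]_(1 + n).
Proof.
move=> dq; have gT := pr_sym mg (proj2 dq).
have mixed a : delta_mx 0 l0 *m N i (rs a) q = delta_mx 0 (rs a) *m N i l0 q :> 'rV[R]_(1 + n).
  rewrite N0// NS /l0 /rs delta_mx_lshift delta_mx_rshift !mul_row_block.
  rewrite !(mulmx0, mul0mx, addr0, add0r) mul_mx_scalar.
  have -> : delta_mx 0 0 = 1%:M :> 'M[R]_1.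
    by apply/matrixP => x y; rewrite !ord1 !mxE.
  by rewrite mul1mx.
rewrite -[m]splitK -[k]splitK.
case: (fintype.split m) => a; case: (fintype.split k) => b /=.
- by rewrite !ord1.
- by rewrite (ord1 a) -mixed.
- by rewrite (ord1 b) mixed.
have := codE a b dq; rewrite !NS.
move: (mpd _ (rs a) _ _ + _) (mpd _ (rs b) _ _ + _) => Xa Xb Xab.
rewrite !delta_mx_rshift !mul_row_block !mulmx0 !mul0mx !add0r Xab; congr row_mx.
have sym1 (M : 'M[R]_1) : M = M^T.
  by apply/matrixP => x y; rewrite !ord1 !mxE.
rewrite -!scalemxAr [delta_mx 0 b *m _]sym1 !trmx_mul !linearZ/=; congr (_ *: _).
by rewrite trmxK gT -(mulmxA _ (g i q.2)) -symE// !mulmxA.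
Qed.

(** The candidate is [warp_conn] transformed back to coordinates. Its compatibility with [gt]
    follows from that of [warp_conn] with [ghat] by the product rule, and [conn_unique]
    concludes. *)
Lemma conn_warp i m q : dom B i q ->
  conn gt i m q *m warp_gauge i q = N i m q.
Proof.
move=> dq; have uG := unitmx_warp_gauge dq.
suff -> : conn gt i m q = N i m q *m invmx (warp_gauge i q) by rewrite mulmxKV.
have mgt := pseudo_riemannian_warp.
apply: (conn_unique (pr_sym mgt dq) (pr_unit mgt dq)
  (G := fun m => N i m q *m invmx (warp_gauge i q))).
  by move=> a b; rewrite !mulmxA warp_torsion_free.
move=> a; rewrite (mpd_eq cB (@oB i) dq dq a (fun q dq _ => gtG dq)).
have sGg : mx_smooth (A := B) i (dom B i) (fun q => warp_gauge i q *m ghat i q).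
  exact: mx_smoothM.
rewrite (mpdM cB (@oB i) dq dq a sGg (mx_smooth_tr (mx_smooth_gauge i))).
rewrite (mpdM cB (@oB i) dq dq a (mx_smooth_gauge i) (mx_smooth_ghat i)).
rewrite mpd_tr mpd_ghat// gtG//.
have -> : N i a q *m invmx (warp_gauge i q) *m
    (warp_gauge i q *m ghat i q *m (warp_gauge i q)^T) =
    N i a q *m ghat i q *m (warp_gauge i q)^T.
  by rewrite !mulmxA mulmxKV.
have hT : (ghat i q)^T = ghat i q.
  rewrite /ghat tr_block_mx !trmx0 tr_scalar_mx linearZ/=.
  by rewrite (pr_sym mg (proj2 dq)).
rewrite /N; move: (mpd _ _ _ _) (warp_conn i a q) => dG W.
rewrite !trmx_mul hT trmxK [(dG + _)^T]linearD/= trmx_mul.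
rewrite !mulmxDl !mulmxDr !mulmxA.
by rewrite mulmxDl -!addrA; do 2!congr (_ + _); rewrite addrC.
Qed.

Lemma conn_curv_warp i m k q : dom B i q ->
  conn_curv (A := B) i (conn gt i) m k q *m warp_gauge i q =
  warp_gauge i q *m conn_curv (A := B) i (warp_conn i) m k q.
Proof.
move=> dq; apply: (gauge_curv cB (@oB i) dq dq) => // [c|c r dr _].
  exact: (mx_smooth_conn_in cB pseudo_riemannian_warp i c (@oB i)).
exact: conn_warp.
Qed.

Let C a : 'cV[R]_n := 2 * eps *: (delta_mx 0 a)^T.

(** For lam = 0, the cylinder, this vanishes, so no curvature involves d_t. For lam = -2 and eps = 1
    it is the mixed part of a tensor of constant curvature -4. *)
Lemma warp_curv0S i a q : dom B i q ->
  conn_curv (A := B) i (warp_conn i) l0 (rs a) q =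
  block_mx 0 (- 2 * lam *: delta_mx 0 a)
    ((2 * eps * lam * w q) *: (g i q.2 *m (delta_mx 0 a)^T)) 0.
Proof.
move=> dq; rewrite /conn_curv.
have -> : warp_conn i l0 = fun=> block_mx 0 0 0 lam%:M.
  by apply/funext => r; exact: warp_conn0.
rewrite mpd_cst subr0 warp_connS (mpd_block (A := B)) !mpd_cst.
rewrite (mpd_line_snd cA (conn g i a) dq).
have sgC : mx_smooth (A := B) i (dom B i) (fun q => g i q.2 *m C a).
  by apply: mx_smoothM => //; exact: mx_smooth_cst.
rewrite (mpdZ cB dq dq l0 (sw i) sgC) dw0//.
rewrite (mpd_line_snd cA (fun x => g i x *m C a) dq) scaler0 addr0.
rewrite !mulmx_block !(mulmx0, mul0mx, addr0, add0r).
rewrite !mul_mx_scalar !mul_scalar_mx add_block_mx opp_block_mx add_block_mx.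
rewrite !(oppr0, addr0, add0r) subrr scalerA; congr block_mx.
  by rewrite scalerA mulrC.
rewrite -scalerBl /C -scalemxAr scalerA; congr (_ *: _).
by ring.
Qed.

(** The Gauss equation: the correction to the curvature of [g] is the product of the off-diagonal
    blocks of [warp_conn]. The vanishing off-diagonal blocks express the Codazzi-Mainardi
    equation. *)
Lemma warp_curvSS i a b q : dom B i q ->
  conn_curv (A := B) i (warp_conn i) (rs a) (rs b) q =
  block_mx 0 0 0 (conn_curv (A := A) i (conn g i) a b q.2 - (4 * eps * w q) *:
    (g i q.2 *m ((delta_mx 0 b : 'rV[R]_n)^T *m delta_mx 0 a -
      (delta_mx 0 a : 'rV[R]_n)^T *m delta_mx 0 b))).
Proof.
move=> dq; have gT := pr_sym mg (proj2 dq).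
have dS c d : mpd (A := B) i (rs c) (warp_conn i (rs d)) q =
    block_mx 0 0 (w q *: (mpd (A := A) i c (g i) q.2 *m C d)) (mpd (A := A) i c (conn g i d) q.2).
  rewrite warp_connS (mpd_block (A := B)) !mpd_cst.
  have sgC : mx_smooth (A := B) i (dom B i) (fun q => g i q.2 *m C d).
    by apply: mx_smoothM => //; exact: mx_smooth_cst.
  rewrite (mpd_slice (A := A) J i c (fun q => conn g i d q.2) q).
  rewrite (mpdZ cB dq dq (rs c) (sw i) sgC) (dwa c dq) scale0r add0r.
  rewrite (mpd_slice (A := A) J i c (fun q => g i q.2 *m C d) q) /=.
  have dq2 : dom A i q.2 := proj2 dq; have oA := ch_dom_open cA i.
  rewrite (mpdM cA oA dq2 dq2 c (pr_smooth mg i) (mx_smooth_cst cA i oA (C d))).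
  by rewrite mpd_cst mulmx0 addr0.
rewrite /conn_curv !dS !warp_connS -!/(C _) !mulmx_block.
rewrite !(mulmx0, mul0mx, addr0, add0r) !opp_block_mx !add_block_mx.
rewrite !(oppr0, addr0, add0r); congr block_mx.
- have gs : delta_mx 0 b *m (g i q.2 *m C a) = delta_mx 0 a *m (g i q.2 *m C b) :> 'M[R]_1.
    rewrite [LHS](_ : _ = (delta_mx 0 b *m (g i q.2 *m C a))^T); last first.
      by apply/matrixP => x y; rewrite !ord1 [RHS]mxE.
    by rewrite !trmx_mul gT /C linearZ/= trmxK -!scalemxAl -!scalemxAr mulmxA.
  by rewrite -!scalemxAl -!(scalemxAr (w q)) gs subrr.
- by rewrite -!scalemxAl (conn_torsion cA mg a b (proj2 dq)) subrr.
(* Transposed torsion freeness. Once the derivatives of g are expanded as G_a g + (G_a g)^T, it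
   cancels the terms containing the transposes. *)
- have tC : (conn g i a q.2)^T *m C b = (conn g i b q.2)^T *m C a.
    by rewrite /C -!scalemxAr -!trmx_mul (conn_torsion cA mg a b (proj2 dq)).
  rewrite !(conn_compatible cA mg _ (proj2 dq)) -!(scalemxAr (w q)).
  move: (conn g i a q.2) (conn g i b q.2) (g i q.2) gT (C b) (C a) tC => U V M MT y x UV.
  rewrite !trmx_mul MT !mulmxDl -!mulmxA UV.
  mx_ring.
  (* The remaining goal is the slice block, where the factors 2 eps from [C] and -2 from the upper
     right block combine to -4 eps. *)
  rewrite /C -!scalemxAl -!scalemxAr -?scalemxAl -?scalemxAl !scalerA.
  rewrite mulmxBr scalerBr !mulmxA.
  move: (mpd _ _ _ _) (mpd _ _ _ _) (conn g i a q.2) (conn g i b q.2) => X Y U V.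
  mx_ring.
Qed.

End Warp.

#[local] Opaque conn_curv.

Lemma bval_delta (R : realType) n (h : 'M[R]_n) a b :
  bval h (delta_mx 0 a) (delta_mx 0 b) = h a b.
Proof. by rewrite /bval -rowE trmx_delta -colE !mxE. Qed.

Lemma riemannian_pseudo (R : realType) n (T : topologicalType)
    (A : atlas R n T) (g : bfields A) : riemannian g -> pseudo_riemannian g.
Proof.
move=> [[sg _] pg]; split=> [i k l|i p dp|i p dp].
- by apply: smooth_in_subset (sg i k l i).
- have [_ pos] := pg i p dp; rewrite -row_free_unit -kermx_eq0.
  apply/rowV0P => v /sub_kermxP vg; apply/eqP; apply: contraT => /pos.
  by rewrite /bval vg mul0mx mxE ltxx.
- have [sym _] := pg i p dp; apply/matrixP => a b; rewrite mxE.
  have := sym (delta_mx 0 b) (delta_mx 0 a).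
  by rewrite !bval_delta.
Qed.

(** * The warped product metric on M *)

Section Wp.
Variables (R : realType) (n : nat) (F : topologicalType) (A : atlas R n F).
Variable gF : bfields A.
Hypothesis cA : charted A.
Hypothesis mF : pseudo_riemannian gF.
Notation B := (wp_atlas A).
Notation gwp := (wp_metric gF).

Let w (q : R * F) := expR (- 4 * q.1).
Let E (i : idx A) (q : R * F) : 'M[R]_n := 1%:M.

Let sw i : smooth_in (A := B) i (dom B i) w.
Proof. exact: smooth_in_expR. Qed.

Let sE i : mx_smooth (A := B) i (dom B i) (E i).
Proof.
apply: mx_smooth_cst; first exact: charted_line openT.
exact: ch_dom_open (charted_line cA openT) i.
Qed.

Let uE i q : dom B i q -> E i q \in unitmx.
Proof. by rewrite unitmx1. Qed.

Let w0 q : w q != 0.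
Proof. by rewrite gt_eqF// expR_gt0. Qed.

Let one2 : 1 * 1 = 1 :> R. Proof. exact: mulr1. Qed.

Let gtE i q : dom B i q ->
  gwp i q = block_mx 1%:M 0 0 (w q *: (E i q *m gF i q.2 *m (E i q)^T)).
Proof. by move=> _; rewrite /E trmx1 mul1mx mulmx1. Qed.

Lemma pseudo_riemannian_wp : pseudo_riemannian gwp.
Proof. exact: (pseudo_riemannian_warp cA openT mF sE uE sw w0 one2 gtE). Qed.

Let dw0 i q : dom B i q -> pd (A := B) i (lshift n 0) w q = 2 * - 2 * w q.
Proof.
move=> [_ dq]; rewrite (pd_line cA setT w dq) /w /=.
have [h|_ ->] := derive_linear_comp expR (L := fun s : R => - 4 * s)
    (x := q.1) (v := 1) (w := - 4).
  by rewrite mulrDr [h *: 1]mulr1 mulrC.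
by rewrite (@derive_val _ _ _ _ _ _ _ (is_derive_expR_dir _ _)) mulrN -natrM.
Qed.

Let dwa i a q : dom B i q -> pd (A := B) i (rshift 1 a) w q = 0.
Proof.
by move=> _; rewrite (pd_slice (A := A)) /w /=; exact: pd_cst.
Qed.

Let dE i q : dom B i q ->
  mpd (A := B) i (lshift n 0) (E i) q + - 2 *: E i q = (- 2)%:M.
Proof. by move=> _; rewrite mpd_cst add0r /E scale_scalar_mx mulr1. Qed.

Let symE i q : dom B i q -> E i q *m gF i q.2 = gF i q.2 *m (E i q)^T.
Proof. by move=> _; rewrite /E trmx1 mul1mx mulmx1. Qed.

Let codE i a b q : dom B i q ->
  delta_mx 0 b *m (mpd (A := B) i (rshift 1 a) (E i) q + E i q *m conn gF i a q.2) =
  delta_mx 0 a *m (mpd (A := B) i (rshift 1 b) (E i) q + E i q *m conn gF i b q.2)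
    :> 'rV[R]_n.
Proof.
by move=> [_ dq]; rewrite !mpd_cst !add0r !mul1mx (conn_torsion cA mF a b dq).
Qed.

(** The curvature of F transported to R x F and extended by zero whenever d_s enters; it is what the
    warped product has beyond constant curvature. *)
Definition fiber_curv (i : idx B) (m k : 'I_(1 + n)) (q : R * F) : 'M[R]_(1 + n) :=
  match fintype.split m, fintype.split k with
  | inr a, inr b => block_mx 0 0 0 (conn_curv (A := A) i (conn gF i) a b q.2)
  | _, _ => 0
  end.

(** With X = d_m and Y = d_k, the second term sends Z to -4 (g(Y,Z) X - g(X,Z) Y), the tensor of
    constant curvature -4. As [E] is the identity, the frame is the coordinate frame and the
    formulas for [warp_conn] apply directly. *)
Lemma conn_curv_wp i m k q : dom B i q ->
  conn_curv (A := B) i (conn gwp i) m k q = fiber_curv i m k q -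
  4 *: (gwp i q *m ((delta_mx 0 k : 'rV[R]_(1 + n))^T *m delta_mx 0 m -
                    (delta_mx 0 m : 'rV[R]_(1 + n))^T *m delta_mx 0 k)).
Proof.
move=> dq.
have G1 : warp_gauge (J := setT) E i q = 1%:M by rewrite /warp_gauge scalar_mx_block.
have := conn_curv_warp cA openT mF sE uE symE codE dE sw w0 dw0 dwa one2 gtE m k dq.
rewrite G1 mulmx1 mul1mx => ->.
have K0 a : conn_curv (A := B) i (warp_conn gF w (- 2) 1 i) (lshift n 0) (rshift 1 a) q =
    - 4 *: (gwp i q *m ((delta_mx 0 (rshift 1 a) : 'rV[R]_(1 + n))^T *m delta_mx 0 (lshift n 0) -
                    (delta_mx 0 (lshift n 0) : 'rV[R]_(1 + n))^T *m delta_mx 0 (rshift 1 a))).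
  rewrite (warp_curv0S cA openT 1 mF sw dw0 a dq).
  have d00 : delta_mx 0 0 = 1%:M :> 'M[R]_1.
    by apply/matrixP => x y; rewrite !ord1 !mxE.
  rewrite !delta_mx_rshift !delta_mx_lshift d00 /wp_metric !tr_row_mx !trmx0 trmx1.
  rewrite !mul_col_row opp_block_mx add_block_mx mulmx_block scale_block_mx.
  rewrite !(mulmx0, mul0mx, mulmx1, mul1mx, oppr0, addr0, add0r, scaler0).
  rewrite scalerN -scaleNr -scalemxAl scalerA.
  by congr block_mx; congr (_ *: _); rewrite ?/w; ring.
rewrite -[m]splitK -[k]splitK /fiber_curv !unsplitK.
case: (fintype.split m) => a; case: (fintype.split k) => b /=.
- by rewrite !ord1 conn_curv_diag subrr mulmx0 scaler0 subr0.
- by rewrite !ord1 K0 scaleNr sub0r.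
- by rewrite !ord1 conn_curvC K0 sub0r scaleNr -!scalerN -mulmxN opprB.
- rewrite (warp_curvSS cA openT (- 2) 1 mF sw dwa a b dq).
  rewrite !delta_mx_rshift /wp_metric !tr_row_mx !trmx0.
  rewrite !mul_col_row opp_block_mx add_block_mx mulmx_block scale_block_mx.
  rewrite !(mulmx0, mul0mx, mulmx1, mul1mx, oppr0, addr0, add0r, scaler0).
  rewrite opp_block_mx add_block_mx !subr0; congr block_mx; congr (_ - _).
  by rewrite -scalemxAl scalerA mulr1.
Qed.

End Wp.

(** * The cylinder *)

Section BlockSums.
Variables (R : realType) (n : nat).

Lemma sum_fiber (V : lmodType R) (x y : 'rV[R]_(1 + n))
    (K : 'I_(1 + n) -> 'I_(1 + n) -> V) (K' : 'I_n -> 'I_n -> V) :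
  (forall m k, K m k = match fintype.split m, fintype.split k with
                       | inr a, inr b => K' a b | _, _ => 0 end) ->
  \sum_m \sum_k (x 0 m * y 0 k) *: K m k =
  \sum_a \sum_b (rsubmx x 0 a * rsubmx y 0 b) *: K' a b.
Proof.
move=> KE; rewrite big_split_ord/= [X in X + _]big1 ?add0r => [|a _]; last first.
  by rewrite big1// => k _; rewrite KE (unsplitK (inl _)) scaler0.
apply: eq_bigr => a _.
rewrite big_split_ord/= [X in X + _]big1 ?add0r => [|b _]; last first.
  by rewrite KE (unsplitK (inr _)) (unsplitK (inl _)) scaler0.
by apply: eq_bigr => b _; rewrite KE !(unsplitK (inr _)) !mxE.
Qed.

Lemma mulmx_sum2 (I J : finType) r s t u (c : I -> J -> R) (K : I -> J -> 'M[R]_(s, t))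
    (P : 'M[R]_(r, s)) (Q : 'M[R]_(t, u)) :
  \sum_a \sum_b c a b *: (P *m K a b *m Q) =
  P *m (\sum_a \sum_b c a b *: K a b) *m Q.
Proof.
rewrite mulmx_sumr mulmx_suml; apply: eq_bigr => a _.
rewrite mulmx_sumr mulmx_suml; apply: eq_bigr => b _.
by rewrite -scalemxAr -scalemxAl.
Qed.

Lemma block_mx_dr r s (K : 'M[R]_(r, s)) :
  block_mx 0 0 0 K = col_mx 0 1%:M *m K *m row_mx 0 1%:M :> 'M[R]_(1 + r, 1 + s).
Proof.
by rewrite mul_col_mx mul_col_row !mulmx0 !mul0mx mul1mx mulmx1.
Qed.

Lemma mul_col01 r (u : 'rV[R]_(1 + r)) : u *m col_mx 0 1%:M = rsubmx u.
Proof. by rewrite -{1}[u]hsubmxK mul_row_col mulmx0 mulmx1 add0r. Qed.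

Lemma mul_row01 r (u : 'rV[R]_r) : u *m row_mx 0 1%:M = row_mx 0 u :> 'rV[R]_(1 + r).
Proof. by rewrite mul_mx_row mulmx0 mulmx1. Qed.

End BlockSums.

Lemma sum_outer (R : realType) n (x y : 'rV[R]_n) :
  \sum_a \sum_b (x 0 a * y 0 b) *: ((delta_mx 0 b : 'rV[R]_n)^T *m delta_mx 0 a) =
  y^T *m x :> 'M[R]_n.
Proof.
rewrite [in RHS](row_sum_delta x) mulmx_sumr; apply: eq_bigr => a _.
rewrite [in RHS](row_sum_delta y) linear_sum/= mulmx_suml; apply: eq_bigr => b _.
by rewrite [(y 0 b *: _)^T]linearZ/= -scalemxAr -scalemxAl scalerA.
Qed.

Section Cylinder.
Variables (R : realType) (n : nat) (F : topologicalType) (A : atlas R n F).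
Variables (gF : bfields A) (H : efields (wp_atlas A)).
Hypothesis cA : charted A.
Hypothesis mF : pseudo_riemannian gF.
Hypothesis H_codazzi : codazzi (wp_metric gF) H.
Hypothesis H_pos : exists2 c : R, 0 < c & forall l, eigenvals H l -> c <= l.
Notation J := (cyl_interval H).
Notation M := (wp_atlas A).
Notation B := (cyl_atlas H).
Notation gwp := (wp_metric gF).
Notation gC := (cyl_metric H gF).

Lemma open_cyl_interval : open J.
Proof. by apply: openI; [exact: open_ereal_gt|exact: open_ereal_lt]. Qed.

(** Provides a slice on which flatness of the cylinder can be evaluated. Since all eigenvalues are
    at least c > 0, the lower end is -oo and the upper end is at least c / 2. *)
Lemma cyl_interval0 : J 0.
Proof.
case: H_pos => c c0 cH; split.
  rewrite /cyl_a [X in ereal_sup X](_ : _ = set0) ?ereal_sup0 ?ltNye//.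
  apply/seteqP; split=> // y [l [/cH cl l0] _].
  by have := lt_le_trans c0 cl; rewrite ltNge ltW.
apply: (@lt_le_trans _ _ (c / 2)%:E); first by rewrite lte_fin divr_gt0.
apply: le_ereal_inf_tmp => _ [l [/cH cl _] <-].
by rewrite lee_fin ler_pM2r ?invr_gt0.
Qed.

(** If H_t were singular, 2t would be an eigenvalue of [H], positive by [H_pos], so t would be at
    least the upper end of the interval. *)
Lemma unitmx_Ht i t x : J t -> dom M i x -> Ht H t i x \in unitmx.
Proof.
move=> [_ tb] dx; apply: contraT => nu.
have e2t : eigenvals H (2 * t).
  by exists i, x; split=> //; rewrite /eigenvalue /eigenspace kermx_eq0 row_free_unit.
case: H_pos => c c0 /(_ _ e2t) ct.
move: tb; rewrite ltNge => /negP; case; apply: ge_ereal_inf.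
exists t%:E => //; exists (2 * t); last by rewrite mulrC mulKf.
by split=> //; exact: lt_le_trans ct.
Qed.

Let cM : charted M := charted_line cA openT.
Let mwp : pseudo_riemannian gwp := pseudo_riemannian_wp cA mF.

Let E (i : idx M) (q : R * (R * F)) : 'M[R]_(1 + n) := Ht H q.1 i q.2.
Let one (q : R * (R * F)) : R := 1.

Let sH i : mx_smooth (A := M) i (dom M i) (H i).
Proof.
by case: H_codazzi => -[s _] _ _ k l; apply: smooth_in_subset (s i k l i).
Qed.

Let EE i : E i = fun q => H i q.2 + q.1 *: (- 2)%:M.
Proof.
by apply/funext => q; rewrite /E /Ht scale_scalar_mx mulrN raddfN/= mulrC.
Qed.

Let cB : charted B := charted_line cM open_cyl_interval.
Let oB i : open (dom B i) := ch_dom_open cB i.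

Let sE i : mx_smooth (A := B) i (dom B i) (E i).
Proof.
rewrite EE; apply: mx_smoothD => //; first exact: mx_smooth_snd.
apply: mx_smoothZ => //; first exact: smooth_in_fst.
exact: mx_smooth_cst.
Qed.

Let uE i q : dom B i q -> E i q \in unitmx.
Proof. by move=> [Jq dq]; exact: unitmx_Ht. Qed.

Let symH i x : dom M i x -> H i x *m gwp i x = gwp i x *m (H i x)^T.
Proof.
move=> dx; case: H_codazzi => _ sym _; apply/matrixP => a b.
have := sym i x dx (delta_mx 0 a) (delta_mx 0 b).
rewrite -(bval_delta (H i x *m _)) -(bval_delta (_ *m (H i x)^T)).
by rewrite /bval trmx_mul !mulmxA.
Qed.

Let symE i q : dom B i q -> E i q *m gwp i q.2 = gwp i q.2 *m (E i q)^T.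
Proof.
move=> [_ dq]; rewrite /E /Ht linearB/= mulmxBl mulmxBr symH// tr_scalar_mx.
by rewrite scalar_mxC.
Qed.

Let s1 i : smooth_in (A := B) i (dom B i) one.
Proof. exact: smooth_in_cst. Qed.

Let one0 q : one q != 0.
Proof. exact: oner_neq0. Qed.

Let d01 i q : dom B i q -> pd (A := B) i (lshift (1 + n) 0) one q = 2 * 0 * one q.
Proof. by move=> _; rewrite mulr0 mul0r; exact: pd_cst. Qed.

Let da1 i a q : dom B i q -> pd (A := B) i (rshift 1 a) one q = 0.
Proof. by move=> _; exact: pd_cst. Qed.

Let mone2 : - 1 * - 1 = 1 :> R.
Proof. by rewrite mulrNN mulr1. Qed.

Let gtE i q : dom B i q ->
  gC i q = block_mx (- 1)%:M 0 0 (one q *: (E i q *m gwp i q.2 *m (E i q)^T)).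
Proof. by move=> _; rewrite /one scale1r. Qed.

Let dE i q : dom B i q ->
  mpd (A := B) i (lshift (1 + n) 0) (E i) q + 0 *: E i q = (- 2)%:M.
Proof.
move=> dq; rewrite scale0r addr0 EE.
have sf : mx_smooth (A := B) i (dom B i) (fun q => q.1 *: (- 2)%:M : 'M[R]_(1 + n)).
  by apply: mx_smoothZ => //; [exact: smooth_in_fst|exact: mx_smooth_cst].
rewrite (mpdD dq dq _ (mx_smooth_snd cM _ (sH i)) sf).
rewrite (mpd_line_snd cM (H i) dq) add0r.
have sfst : smooth_in (A := B) i (dom B i) fst by exact: smooth_in_fst.
rewrite (mpdZ cB dq dq _ sfst (mx_smooth_cst cB i (@oB i) (- 2)%:M)).
rewrite mpd_cst scaler0 addr0 (pd_line cM _ _ (proj2 dq)) /=.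
by rewrite derive_id scale1r.
Qed.

(** H_t inherits the Codazzi equation from [H]: within a slice it differs from [H] by a constant
    multiple of the identity, which is parallel, so torsion freeness takes care of that multiple. *)
Let codE i a b q : dom B i q ->
  delta_mx 0 b *m (mpd (A := B) i (rshift 1 a) (E i) q + E i q *m conn gwp i a q.2) =
  delta_mx 0 a *m (mpd (A := B) i (rshift 1 b) (E i) q + E i q *m conn gwp i b q.2)
    :> 'rV[R]_(1 + n).
Proof.
move=> [_ dq]; have oM := ch_dom_open cM i.
have dHt c : mpd (A := B) i (rshift 1 c) (E i) q = mpd (A := M) i c (H i) q.2.
  rewrite (mpd_slice (A := M) J i c (E i) q).
  have -> : (fun x => E i (q.1, x)) = (fun x => H i x + (- (2 * q.1))%:M).
    by apply/funext => x; rewrite /E /Ht raddfN.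
  by rewrite (mpdD dq dq _ (sH i) (mx_smooth_cst cM i oM _)) mpd_cst addr0.
have := codazzi_conn cM mwp a b H_codazzi dq.
rewrite !dHt /E /Ht !mulmxBl !mul_scalar_mx !addrA !mulmxBr => ->.
by rewrite -!scalemxAr (conn_torsion cM mwp a b dq).
Qed.

Lemma pseudo_riemannian_cyl : pseudo_riemannian gC.
Proof.
exact: (pseudo_riemannian_warp cM open_cyl_interval mwp sE uE s1 one0 mone2 gtE).
Qed.

Let G (i : idx M) (q : R * (R * F)) : 'M[R]_(1 + (1 + n)) := block_mx 1%:M 0 0 (E i q).

(* The curvature of gC in the frame formed by d_t and the images of the
   coordinate fields under Ht^-1. *)
Definition cyl_curv (i : idx B) (m k : 'I_(1 + (1 + n))) (q : R * (R * F)) :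
    'M[R]_(1 + (1 + n)) :=
  match fintype.split m, fintype.split k with
  | inr a, inr b => block_mx 0 0 0 (fiber_curv gF i a b q.2)
  | _, _ => 0
  end.

Lemma conn_curv_cyl i m k q : dom B i q ->
  conn_curv (A := B) i (conn gC i) m k q *m G i q = G i q *m cyl_curv i m k q.
Proof.
move=> dq.
rewrite (conn_curv_warp cM open_cyl_interval mwp sE uE symE codE dE s1 one0 d01 da1
  mone2 gtE m k dq).
congr (_ *m _).
have K0 a : conn_curv (A := B) i (warp_conn gwp one 0 (- 1) i)
    (lshift (1 + n) 0) (rshift 1 a) q = 0.
  rewrite (warp_curv0S cM open_cyl_interval _ mwp s1 d01 a dq).
  by rewrite !mulr0 !mul0r !scale0r block_mx0.
rewrite -[m]splitK -[k]splitK /cyl_curv !unsplitK.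
case: (fintype.split m) => a; case: (fintype.split k) => b /=.
- by rewrite !ord1 conn_curv_diag.
- by rewrite !ord1 K0.
- by rewrite !ord1 conn_curvC K0 oppr0.
rewrite (warp_curvSS cM open_cyl_interval _ _ mwp s1 da1 a b dq).
rewrite (conn_curv_wp cA mF a b (proj2 dq)) /one mulr1 mulrN1 scaleNr opprK.
by rewrite subrK.
Qed.

(** The source of all the curvature statements: components along d_t drop out of every argument, and
    Z is conjugated by H_t. Smoothness is asked of components in chart [i] only, so fields given by
    a formula can be inserted directly. *)
Lemma curv_cyl (D : set (R * (R * F))) (X Y Z : vfields B) i q : open D ->
  mx_smooth (A := B) i D (X i) -> mx_smooth (A := B) i D (Y i) ->
  mx_smooth (A := B) i D (Z i) -> D q -> dom B i q ->
  curv gC X Y Z i q = row_mx 0 (rsubmx (Z i q) *m Ht H q.1 i q.2 *m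
    (\sum_a \sum_b (rsubmx (X i q) 0 a * rsubmx (Y i q) 0 b) *: fiber_curv gF i a b q.2)
    *m Htinv H q.1 i q.2).
Proof.
move=> oD sX sY sZ Dq dq.
rewrite (curv_conn cB oD Dq dq sX sY sZ) => [|a]; last first.
  exact: (mx_smooth_conn_in cB pseudo_riemannian_cyl i a oD).
have KE m k : conn_curv (A := B) i (conn gC i) m k q =
    G i q *m cyl_curv i m k q *m block_mx 1%:M 0 0 (invmx (E i q)).
  rewrite -conn_curv_cyl// -mulmxA mulmx_block !(mulmx0, mul0mx, addr0, add0r).
  by rewrite mulmx1 mulmxV ?uE// -scalar_mx_block mulmx1.
under eq_bigr => m _ do under eq_bigr => k _ do rewrite KE !mulmxA.
rewrite mulmx_sum2.
have -> : \sum_m \sum_k (X i q 0 m * Y i q 0 k) *: cyl_curv i m k q =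
    col_mx 0 1%:M *m (\sum_a \sum_b (rsubmx (X i q) 0 a * rsubmx (Y i q) 0 b) *:
      fiber_curv gF i a b q.2) *m row_mx 0 1%:M.
  rewrite -mulmx_sum2; apply: sum_fiber => m k; rewrite /cyl_curv.
  by case: (fintype.split m) => a; case: (fintype.split k) => b //; rewrite block_mx_dr.
rewrite !mulmxA mul_col01 -{1}[Z i q]hsubmxK /G mul_row_block row_mxKr mulmx0 add0r.
by rewrite -mulmxA mul_row_block !(mulmx0, mul0mx, addr0, add0r) mul1mx mul_mx_row mulmx0.
Qed.

Lemma curv_cyl_fiber (D : set (R * (R * F))) (X Y Z : vfields B) i q : open D ->
  mx_smooth (A := B) i D (X i) -> mx_smooth (A := B) i D (Y i) ->
  mx_smooth (A := B) i D (Z i) -> D q -> dom B i q ->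
  curv gC X Y Z i q = row_mx 0 (row_mx 0 (rsubmx (rsubmx (Z i q) *m Ht H q.1 i q.2) *m
    (\sum_a \sum_b (rsubmx (rsubmx (X i q)) 0 a * rsubmx (rsubmx (Y i q)) 0 b) *:
       conn_curv (A := A) i (conn gF i) a b q.2.2))
    *m Htinv H q.1 i q.2).
Proof.
move=> oD sX sY sZ Dq dq; rewrite (curv_cyl oD sX sY sZ Dq dq); congr row_mx.
have -> : \sum_a \sum_b (rsubmx (X i q) 0 a * rsubmx (Y i q) 0 b) *: fiber_curv gF i a b q.2 =
    col_mx 0 1%:M *m (\sum_a \sum_b
      (rsubmx (rsubmx (X i q)) 0 a * rsubmx (rsubmx (Y i q)) 0 b) *:
       conn_curv (A := A) i (conn gF i) a b q.2.2) *m row_mx 0 1%:M.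
  rewrite -mulmx_sum2; apply: sum_fiber => m k; rewrite /fiber_curv.
  by case: (fintype.split m) => a; case: (fintype.split k) => b //; rewrite block_mx_dr.
by rewrite !mulmxA mul_col01 mul_row01.
Qed.

Lemma flat_cyl : flat gC <-> flat gF.
Proof.
rewrite (flat_conn cB pseudo_riemannian_cyl) (flat_conn cA mF).
split=> [K0 i a b p dp|K0 i m k q dq]; last first.
  have : conn_curv (A := B) i (conn gC i) m k q *m G i q = 0.
    rewrite conn_curv_cyl// /cyl_curv /fiber_curv.
    case: (fintype.split m) => a; case: (fintype.split k) => b; rewrite ?mulmx0//.
    case: (fintype.split a) => c; case: (fintype.split b) => d; rewrite ?block_mx0 ?mulmx0//.
    by rewrite K0 ?block_mx0 ?mulmx0//; exact: (proj2 (proj2 dq)).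
  move/(congr1 (fun K => K *m invmx (G i q))); rewrite mul0mx mulmxK//.
  exact: (unitmx_block_diag (unitmx1 _ _) (uE dq)).
(* The slice block of [cyl_curv] depends on the point of F only, so it can be read off at t = 0, s =
   0. *)
have dq : dom B i (0, (0, p)) by split; [exact: cyl_interval0|split].
have := conn_curv_cyl (rshift 1 (rshift 1 a)) (rshift 1 (rshift 1 b)) dq.
rewrite K0// mul0mx => /esym/(congr1 (fun K => invmx (G i (0, (0, p))) *m K)).
rewrite mulmxA mulVmx; last exact: (unitmx_block_diag (unitmx1 _ _) (uE dq)).
rewrite mul1mx mulmx0 /cyl_curv /fiber_curv !(unsplitK (inr _)).
move/(congr1 (fun K : 'M[R]_(1 + (1 + n)) => drsubmx (drsubmx K))).
by rewrite !block_mxKdr; move=> ->; apply/matrixP => x y; rewrite !mxE.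
Qed.

Lemma mx_smooth_to_cyl (D : set (R * F)) (X : vfields M) i : open D ->
  mx_smooth (A := M) i D (X i) ->
  mx_smooth (A := B) i [set q | D q.2] (to_cyl H X i).
Proof.
move=> oD sX; apply: mx_smooth_row; first by apply: mx_smooth_cst => //; exact: open_snd.
exact: (mx_smooth_snd_in cM _ oD).
Qed.

Lemma mx_smooth_Htinv_cyl (D : set (R * F)) (X : vfields M) i : open D ->
  mx_smooth (A := M) i D (X i) ->
  mx_smooth (A := B) i [set q | D q.2] (Htinv_cyl H X i).
Proof.
move=> oD sX; have oD' : open [set q : R * (R * F) | D q.2] by exact: open_snd.
apply: mx_smooth_row; first exact: mx_smooth_cst.
apply: mx_smoothM => //; first exact: (mx_smooth_snd_in cM _ oD).
apply: mx_smooth_inv => // [|q _ dq]; last exact: uE.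
by apply: mx_smooth_subset (sE i) => q.
Qed.

(** The H_t^-1 carried by Z cancels the H_t of the frame, so the curvature of F acts on Z itself;
    (iii) and (iv) are its special cases. *)
Lemma curv_cyl_Htinv (D : set (R * F)) (X Y Z : vfields M) i q : open D ->
  mx_smooth (A := M) i D (X i) -> mx_smooth (A := M) i D (Y i) ->
  mx_smooth (A := M) i D (Z i) -> D q.2 -> dom B i q ->
  curv gC (to_cyl H X) (to_cyl H Y) (Htinv_cyl H Z) i q =
  row_mx 0 (row_mx 0 (rsubmx (Z i q.2) *m
    (\sum_a \sum_b (rsubmx (X i q.2) 0 a * rsubmx (Y i q.2) 0 b) *:
       conn_curv (A := A) i (conn gF i) a b q.2.2)) *m Htinv H q.1 i q.2).
Proof.
move=> oD sX sY sZ Dq dq.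
rewrite (curv_cyl_fiber (open_snd oD) (mx_smooth_to_cyl oD sX) (mx_smooth_to_cyl oD sY)
  (mx_smooth_Htinv_cyl oD sZ) Dq dq).
by rewrite /to_cyl /lift_vf /Htinv_cyl !row_mxKr mulmxKV//; exact: uE.
Qed.

Lemma curv_cyl_slice (D : set (R * (R * F))) (X Y V : vfields B) i t x : open D ->
  mx_smooth (A := B) i D (X i) -> mx_smooth (A := B) i D (Y i) ->
  mx_smooth (A := B) i D (V i) -> D (t, x) -> dom B i (t, x) ->
  let HV := eapp (Ht H t) (slice t V) in
  curv gC X Y V i (t, x) =
    row_mx 0 (eapp (Htinv H t) (curv gwp (slice t X) (slice t Y) HV) i x
      - (4 * bval (gwp i x) (slice t X i x) (HV i x)) *: eapp (Htinv H t) (slice t Y) i x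
      + (4 * bval (gwp i x) (slice t Y i x) (HV i x)) *: eapp (Htinv H t) (slice t X) i x).
Proof.
move=> oD sX sY sV Dq dq HV; have [/= Jt dx] := dq.
rewrite (curv_cyl oD sX sY sV Dq dq) /=; congr row_mx.
have oDt : open [set y | D (t, y)] by exact: open_slice.
have s_slice (Z : vfields B) : mx_smooth (A := B) i D (Z i) ->
    mx_smooth (A := M) i [set y | D (t, y)] (slice t Z i).
  move=> sZ k l; have := smooth_in_slice cM open_cyl_interval oD Jt (sZ k (rshift 1 l)).
  by apply: smooth_in_eq => // y _ _; rewrite mxE.
have sHV : mx_smooth (A := M) i [set y | D (t, y)] (HV i).
  apply: mx_smoothM => //; first exact: s_slice.
  apply: (@mx_smooth_subset _ _ _ M i (dom M i)) => //.
  have -> : Ht H t i = fun y => H i y + (- (2 * t))%:M.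
    by apply/funext => y; rewrite /Ht raddfN.
  have oM := ch_dom_open cM i.
  by apply: mx_smoothD => //; exact: mx_smooth_cst.
rewrite /eapp (curv_conn cM oDt Dq dx (s_slice X sX) (s_slice Y sY) sHV); last first.
  by move=> a; exact: (mx_smooth_conn_in cM mwp i a oDt).
set u := slice t X i x; set v := slice t Y i x.
have -> : rsubmx (V i (t, x)) *m Ht H t i x = HV i x by [].
move: (HV i x) => {HV sHV sV s_slice} z.
rewrite !scalemxAl -mulmxBl -mulmxDl; congr (_ *m _).
(* The formula for R^wp solved for the curvature of F; the constant curvature part becomes the two
   terms with coefficient 4 in (ii). *)
have -> : \sum_a \sum_b (u 0 a * v 0 b) *: fiber_curv gF i a b x =
    \sum_a \sum_b (u 0 a * v 0 b) *: conn_curv (A := M) i (conn gwp i) a b x +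
    4 *: (gwp i x *m (v^T *m u - u^T *m v)).
  rewrite -(sum_outer u v) -(sum_outer v u) [X in _ - X]exchange_big/= -sumrB.
  rewrite mulmx_sumr scaler_sumr -big_split/=; apply: eq_bigr => a _.
  rewrite -sumrB mulmx_sumr scaler_sumr -big_split/=; apply: eq_bigr => b _.
  rewrite (conn_curv_wp cA mF a b dx) [v 0 b * _]mulrC -scalerBr -scalemxAr.
  move: (u 0 a * v 0 b) => c; by rewrite scalerA [4 * _]mulrC -scalerA -scalerDr subrK.
(* A value of the metric is read as a 1 x 1 matrix, so that it can be moved through products;
   symmetry of the metric exchanges the arguments. *)
have bE y : bval (gwp i x) y z *: 1%:M = z *m gwp i x *m y^T.
  rewrite scalemx1 [RHS]mx11_scalar /bval; congr (_%:M).
  have -> : z *m gwp i x *m y^T = (y *m gwp i x *m z^T)^T.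
    by rewrite !trmx_mul trmxK (pr_sym mwp dx) mulmxA.
  by rewrite [RHS]mxE.
have -> : \sum_a \sum_b (u 0 a * v 0 b) *: (z *m conn_curv (A := M) i (conn gwp i) a b x) =
    z *m (\sum_a \sum_b (u 0 a * v 0 b) *: conn_curv (A := M) i (conn gwp i) a b x).
  rewrite mulmx_sumr; apply: eq_bigr => a _; rewrite mulmx_sumr; apply: eq_bigr => b _.
  by rewrite -scalemxAr.
move: (\sum_a _) => S.
rewrite (mulmxDr z S) -scalemxAr !mulmxBr !mulmxA -!bE -!scalemxAl !mul1mx scalerBr !scalerA.
by rewrite -addrA [- _ + _]addrC.
Qed.

End Cylinder.

Theorem proposition12 (R : realType) (n : nat) (F : topologicalType)
    (A : atlas R n F) (gF : bfields A) (H : efields (wp_atlas A))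
    (F_manifold : smooth_manifold A)
    (F_connected : connected [set: F])
    (gF_riemannian : riemannian gF)
    (F_spinor : admits_parallel_spinor gF)
    (F_codazzi : exists (E : efields A) (k : R),
       codazzi gF E /\ forall l, eigenvals E l -> k <= l)
    (H_codazzi : codazzi (wp_metric gF) H)
    (H_pos : exists2 c : R, 0 < c & forall l, eigenvals H l -> c <= l) :
  let gwp := wp_metric gF in
  let C := cyl_atlas H in
  let gC := cyl_metric H gF in
  (* (i) *)
  (forall (D : set (R * (R * F))) (X Y : vfields C), open D ->
     vector_field D X -> vector_field D Y ->
   forall i q, D q -> dom C i q ->
     [/\ curv gC X Y (d_t H) i q = 0,
         curv gC X (d_t H) Y i q = 0
       & curv gC X (d_t H) (d_t H) i q = 0]) /\
  (* (ii) *)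
  (forall (D : set (R * (R * F))) (X Y V : vfields C), open D ->
     vector_field D X -> vector_field D Y -> vector_field D V ->
     tangent_to_slices D X -> tangent_to_slices D Y -> tangent_to_slices D V ->
   forall i t x, D (t, x) -> dom C i (t, x) ->
     let Xt := slice t X in
     let Yt := slice t Y in
     let HV := eapp (Ht H t) (slice t V) in
     curv gC X Y V i (t, x) =
       row_mx 0 (eapp (Htinv H t) (curv gwp Xt Yt HV) i x
         - (4 * bval (gwp i x) (Xt i x) (HV i x)) *: eapp (Htinv H t) Yt i x
         + (4 * bval (gwp i x) (Yt i x) (HV i x)) *: eapp (Htinv H t) Xt i x)) /\
  (* (iii) *)
  (forall (D : set F) (X Y V : vfields A), open D ->
     vector_field D X -> vector_field D Y -> vector_field D V ->
   forall i t s p, D p -> dom C i (t, (s, p)) ->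
     curv gC (to_cyl H (fiber_lift X)) (to_cyl H (fiber_lift Y))
             (Htinv_cyl H (fiber_lift V)) i (t, (s, p)) =
     Htinv_cyl H (fiber_lift (curv gF X Y V)) i (t, (s, p))) /\
  (* (iv) *)
  (forall (D : set F) (X Y : vfields A), open D ->
     vector_field D X -> vector_field D Y ->
   forall i t s p, D p -> dom C i (t, (s, p)) ->
     let Xl := to_cyl H (fiber_lift X) in
     let Yl := to_cyl H (fiber_lift Y) in
     [/\ curv gC Xl Yl (Htinv_cyl H (d_s A)) i (t, (s, p)) = 0,
         curv gC (to_cyl H (d_s A)) Yl (Htinv_cyl H (d_s A)) i (t, (s, p)) = 0
       & curv gC (to_cyl H (d_s A)) Yl (Htinv_cyl H (fiber_lift X))
              i (t, (s, p)) = 0]) /\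
  (flat gC <-> flat gF).
Proof.
move=> gwp C gC.
have cA := smooth_manifold_charted F_manifold.
have mF := riemannian_pseudo gF_riemannian.
have cM : charted (wp_atlas A) := charted_line cA openT.
have cC : charted C := charted_line cM (@open_cyl_interval _ _ _ _ H).
split=> [D X Y oD vX vY i q Dq dq|].
  have sX := mx_smooth_vector_field i vX; have sY := mx_smooth_vector_field i vY.
  have st : mx_smooth i D (d_t H i) by exact: mx_smooth_cst.
  (* In each of the three statements d_t enters [curv_cyl] through its slice component, which is
     zero. *)
  have dt0 : rsubmx (d_t H i q) = 0 by exact: row_mxKr.
  split.
  - rewrite (curv_cyl cA mF H_codazzi H_pos oD sX sY st Dq dq) dt0.
    by rewrite !mul0mx row_mx0.
  - rewrite (curv_cyl cA mF H_codazzi H_pos oD sX st sY Dq dq) dt0.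
    rewrite big1 => [|a _]; first by rewrite mulmx0 mul0mx row_mx0.
    by rewrite big1// => b _; rewrite [X in _ * X]mxE mulr0 scale0r.
  - rewrite (curv_cyl cA mF H_codazzi H_pos oD sX st st Dq dq) dt0.
    by rewrite !mul0mx row_mx0.
split=> [D X Y V oD vX vY vV _ _ _ i t x Dq dq|].
  by apply: (curv_cyl_slice cA mF H_codazzi H_pos oD) => //;
    exact: mx_smooth_vector_field.
have lift_smooth (D : set F) (X : vfields A) i : open D -> vector_field D X ->
    mx_smooth (A := wp_atlas A) i [set q | D q.2] (fiber_lift X i).
  move=> oD vX; have oD' : open [set q : R * F | D q.2] by exact: open_snd.
  apply: mx_smooth_row; first exact: mx_smooth_cst.
  have sX := mx_smooth_vector_field (A := A) i vX.
  exact: (mx_smooth_snd_in cA setT oD (fun q Dq => Dq) sX).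
split=> [D X Y V oD vX vY vV i t s p Dp dq|].
  have oD' : open [set q : R * F | D q.2] by exact: open_snd.
  have dp : dom A i p by case: dq => _ [].
  rewrite (curv_cyl_Htinv (q := (t, (s, p))) cA mF H_codazzi H_pos oD' (lift_smooth D X i oD vX)
    (lift_smooth D Y i oD vY) (lift_smooth D V i oD vV) Dp dq).
  rewrite /Htinv_cyl /fiber_lift /lift_vf /eapp !row_mxKr.
  rewrite (curv_vector_field cA mF oD vX vY vV Dp dp).
  rewrite mulmx_sumr; under eq_bigr do rewrite mulmx_sumr.
  by under eq_bigr => a _ do under eq_bigr => b _ do rewrite -scalemxAr.
split=> [D X Y oD vX vY i t s p Dp dq Xl Yl|]; last exact: flat_cyl.
have oD' : open [set q : R * F | D q.2] by exact: open_snd.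
have sX := lift_smooth D X i oD vX; have sY := lift_smooth D Y i oD vY.
have ss : mx_smooth (A := wp_atlas A) i [set q | D q.2] (d_s A i).
  exact: mx_smooth_cst.
(* Likewise d_s has no component along F, and only those components enter [curv_cyl_Htinv]. *)
have ds0 : rsubmx (d_s A i (s, p)) = 0 by exact: row_mxKr.
split.
- rewrite (curv_cyl_Htinv (q := (t, (s, p))) cA mF H_codazzi H_pos oD' sX sY ss Dp dq) ds0.
  by rewrite !mul0mx row_mx0 mul0mx row_mx0.
- rewrite (curv_cyl_Htinv (q := (t, (s, p))) cA mF H_codazzi H_pos oD' ss sY ss Dp dq) ds0.
  by rewrite !mul0mx row_mx0 mul0mx row_mx0.
- rewrite (curv_cyl_Htinv (q := (t, (s, p))) cA mF H_codazzi H_pos oD' ss sY sX Dp dq) ds0.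
  rewrite big1 => [|a _]; first by rewrite mulmx0 row_mx0 mul0mx row_mx0.
  by rewrite big1// => b _; rewrite [X in X * _]mxE mul0r scale0r.
Qed.
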